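(* Let $y(\cdot)$ be the measured output $y(t)=C^{T}x(t;t_0,x_0,\tilde\theta,\tilde\lambda)$ of the system $$\dot{x}=A_0 x+b\,\varphi(y,t)^{T}\tilde\theta+g(y,\tilde\lambda,t),\qquad y=C^{T}x,\qquad x(t_0)=x_0,$$ described in the context, with true (unknown) values $x_0\in\mathbb{R}^n$, $\tilde\theta\in\mathbb{R}^r$, $\tilde\lambda\in\mathbb{R}^{d+k}$. Let $T>0$, and suppose that the sets $\mathcal{E}_0(\tilde\theta,\tilde\lambda,T)$ and $\mathcal{E}(\tilde\theta,\tilde\lambda,T)$ defined in the context coincide and contain no more than one element. Let $y(\cdot)$, $\varphi(y(\cdot),\cdot)$ and $g(y(\cdot),\lambda,\cdot)$ be $T$-periodic on $[t_0,\infty)$ for all $\lambda\in\mathbb{R}^{d+k}$, and let $\varphi(y(\cdot),\cdot)$ satisfy $$\int_{t_0}^{t_0+T}\varphi(y(\tau),\tau)\varphi(y(\tau),\tau)^{T}d\tau\ \geq\ \delta I_r\quad\text{for some }\delta>0 .$$ Let $\Phi(t,t_0)$ and $l$ be as in the context, and for $\lambda'\in\mathbb{R}^{d+k}$ put $$R(\lambda')=(I_{n+r}-\Phi(t_0+T,t_0))^{-1}\Phi(t_0+T,t_0)\int_{t_0}^{t_0+T}\Phi(\tau,t_0)^{-1}\begin{pmatrix} g(y(\tau),\lambda',\tau)-l\,y(\tau)\\ y(\tau)\varphi(y(\tau),\tau)\end{pmatrix}d\tau ,$$ $$\hat{y}(\lambda',t)=(1\ 0\ \cdots\ 0)\left(\Phi(t,t_0)R(\lambda')+\Phi(t,t_0)\int_{t_0}^{t}\Phi(\tau,t_0)^{-1}\begin{pmatrix}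 g(y(\tau),\lambda',\tau)-l\,y(\tau)\\ y(\tau)\varphi(y(\tau),\tau)\end{pmatrix}d\tau\right).$$ Then, for $\lambda'\in\mathbb{R}^{d+k}$, the following statements are equivalent: 1) $\hat{y}(\lambda',t)=y(t)$ for all $t\in[t_0,t_0+T]$; 2) $(1\ 0\ \cdots\ 0)\,x(t;t_0,x_0,\tilde\theta,\lambda')=y(t)$ for all $t\in[t_0,t_0+T]$. Furthermore, when these statements hold, the values of $x_0,\tilde\theta$ satisfy $$\begin{pmatrix}x_0\\ \tilde\theta\end{pmatrix}=R(\lambda').$$
   Context: **System.** $x\in\mathbb{R}^n$; $A_0=\begin{pmatrix}0& I_{n-1}\\ 0&0\end{pmatrix}\in\mathbb{R}^{n\times n}$; $C=(1,0,\dots,0)^{T}\in\mathbb{R}^n$; $b=(1,b_1,\dots,b_{n-1})^{T}$ is such that the polynomial $s^{n-1}+b_1s^{n-2}+\cdots+b_{n-1}$ is Hurwitz (all roots have negative real parts). $\varphi:\mathbb{R}\times\mathbb{R}\to\mathbb{R}^r$ is continuous and differentiable. The function $g$ takes values in $\mathbb{R}^n$ and arises as follows. For $\lambda=(\bar\lambda,q_0)\in\mathbb{R}^{k}\times\mathbb{R}^{d}$, $g(y,\lambda,t)=\tilde v(y,q(t;q_0,\bar\lambda,[y]),\bar\lambda,t)$, where $$q(t;q_0,\bar\lambda,[y])=e^{\int_{t_0}^t\tilde P(y(\tau),\bar\lambda,\tau)d\tau}q_0+\int_{t_0}^t e^{\int_\tau^t\tilde P(y(s),\bar\lambda,s)ds}\tilde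 w(y(\tau),\bar\lambda,\tau)d\tau$$ is the solution of $\dot q=\tilde P(y,\bar\lambda,t)q+\tilde w(y,\bar\lambda,t)$, $q(t_0)=q_0\in\mathbb{R}^d$. Here $\tilde v$ ($\mathbb{R}^n$-valued), $\tilde w$ ($\mathbb{R}^d$-valued) and $\tilde P$ ($\mathbb{R}^{d\times d}$-valued and diagonal) are known continuous and differentiable functions. Thus, for the measured signal $y(\cdot)$, $g(y(t),\lambda,t)$ is a known function of $\lambda$ and $t$. $x(\cdot;t_0,x_0,\theta,\lambda)$ denotes the solution of the system with initial condition $x_0$ and with parameters $\theta\in\mathbb{R}^r$, $\lambda\in\mathbb{R}^{d+k}$ in place of $\tilde\theta,\tilde\lambda$. The solution $x(\cdot;t_0,x_0,\tilde\theta,\tilde\lambda)$ with the true values is assumed to be defined on the time interval considered, and $y(\cdot)$ is its output. **Sets of indistinguishable parameters.** $$\mathcal{E}_0(\tilde\theta,\tilde\lambda,T)=\{(\theta',\lambda')\in\mathbb{R}^r\times\mathbb{R}^{d+k}:\ b\varphi(y(t),t)^{T}(\theta'-\tilde\theta)+g(y(t),\lambda',t)-g(y(t),\tilde\lambda,t)=0\ \ \forall t\in[t_0,t_0+T]\}.$$ Let $\Lambda\in\mathbb{R}^{(n-1)\times(n-1)}$ be the matrix whose first column is $-(b_1,\dots,b_{n-1})^{T}$ and whose remaining $n-2$ columns form $\begin{pmatrix}I_{n-2}\\0\end{pmatrix}$. Let $G=\begin{pmatrix}-(b_1,\dots,b_{n-1})^{T}& I_{n-1}\end{pmatrix}\in\mathbb{R}^{(n-1)\times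 n}$ and $\tilde C=(1,0,\dots,0)^{T}\in\mathbb{R}^{n-1}$. For $\lambda\in\mathbb{R}^{d+k}$ let $z(\cdot;t_0,\lambda)$ be the solution of $\dot z=\Lambda z+G\,g(y(t),\lambda,t)$, $z(t_0)=0$, and let $z_1$ be its first component. Let $g_1$ be the first component of $g$. For $p\in\mathbb{R}^{n-1}$ put $$\eta(\tilde\theta,\tilde\lambda,\theta',\lambda',p,t)=\varphi(y(t),t)^{T}(\theta'-\tilde\theta)+g_1(y(t),\lambda',t)-g_1(y(t),\tilde\lambda,t)+\tilde C^{T}e^{\Lambda(t-t_0)}p+z_1(t;t_0,\lambda')-z_1(t;t_0,\tilde\lambda).$$ Then $$\mathcal{E}(\tilde\theta,\tilde\lambda,T)=\{(\theta',\lambda')\in\mathbb{R}^r\times\mathbb{R}^{d+k}:\ \exists\,p\in\mathbb{R}^{n-1}\text{ with }\eta(\tilde\theta,\tilde\lambda,\theta',\lambda',p,t)=0\ \ \forall t\in[t_0,t_0+T]\}.$$ **The vector $l$ and matrix $\Phi$.** $l\in\mathbb{R}^n$ is a vector for which there exist symmetric positive definite matrices $P,Q$ with $P(A_0+lC^{T})+(A_0+lC^{T})^{T}P=-Q$ and $Pb=C$ (such $l$ exists because of the Hurwitz condition on $b$). $\Phi(t,t_0)$ is the fundamental solution matrix, normalized by $\Phi(t_0,t_0)=I_{n+r}$, of the linear system $$\frac{d}{dt}\begin{pmatrix}\xi_1\\ \xi_2\end{pmatrix}=\begin{pmatrix}A_0+lC^{T}& b\,\varphi(y(t),t)^{T}\\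 -\varphi(y(t),t)C^{T}&0\end{pmatrix}\begin{pmatrix}\xi_1\\ \xi_2\end{pmatrix},\qquad \xi_1\in\mathbb{R}^n,\ \xi_2\in\mathbb{R}^r.$$ *)

(* Defs.v *)
From HB Require Import structures.
From mathcomp Require Import all_boot all_order all_algebra.
From mathcomp Require Import complex.
From mathcomp Require Import all_classical all_reals all_analysis.
Set Implicit Arguments.
Unset Strict Implicit.
Unset Printing Implicit Defensive.
Import Order.TTheory GRing.Theory Num.Theory.
Import numFieldNormedType.Exports.
Local Open Scope classical_set_scope.
Local Open Scope ring_scope.

(* The state space has dimension n = m + 1.  For n = 1 the matrices of size
   n - 1 are empty and the terms they produce vanish.  A parameter
   lambda = (bar lambda, q0) is a pair in 'cV_k * 'cV_d. *)

Section Calculus.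
Variable R : realType.

(* The quotient is taken within D, so at an endpoint of an interval D the
   derivative is one-sided. *)
Definition has_derivative_on (V : normedModType R) (D : set R)
    (X dX : R -> V) : Prop :=
  forall t, D t ->
    (fun s => (s - t)^-1 *: (X s - X t)) @ within D t^' --> dX t.

Definition mxintegral p q (a b : R) (F : R -> 'M[R]_(p, q)) : 'M[R]_(p, q) :=
  \matrix_(i, j) \int[lebesgue_measure]_(s in `[a, b]) F s i j.

Definition expmx p (A : 'M[R]_p) : 'M[R]_p :=
  limn (series (fun i : nat => (i`!%:R)^-1 *: A ^+ i)).

Definition periodic_from (V : Type) (t0 T : R) (f : R -> V) : Prop :=
  forall t, t0 <= t -> f (t + T) = f t.

Definition possemidef p (A : 'M[R]_p) : Prop :=
  A^T = A /\ forall v : 'cV[R]_p, 0 <= (v^T *m A *m v) 0 0.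

Definition posdef p (A : 'M[R]_p) : Prop :=
  A^T = A /\ forall v : 'cV[R]_p, v != 0 -> 0 < (v^T *m A *m v) 0 0.

Definition hurwitz (p : {poly R}) : Prop :=
  forall s : R[i], root (map_poly (real_complex R) p) s -> complex.Re s < 0.

End Calculus.

Section ConstantMatrices.
Variable R : realType.

Definition shiftmx n : 'M[R]_n := \matrix_(i, j) ((j : nat) == i.+1)%:R.

Definition firstv n : 'cV[R]_n := \col_i ((i : nat) == 0%N)%:R.

(* bb holds (b_1, ..., b_(n-1)); the leading coefficient 1 of b is added by
   bvec. *)
Variable m : nat.
Implicit Type bb : 'cV[R]_m.

Definition bvec bb : 'cV[R]_m.+1 := col_mx (1%:M : 'M[R]_1) bb.

Definition bpoly bb : {poly R} :=
  \sum_(i < m.+1) (bvec bb) i 0 *: 'X^(m - i).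

Definition Lambdamx bb : 'M[R]_m :=
  \matrix_(i, j) if (j : nat) == 0%N then - bb i 0 else ((j : nat) == i.+1)%:R.

Definition Gmx bb : 'M[R]_(m, m.+1) := row_mx (- bb) (1%:M : 'M[R]_m).

End ConstantMatrices.

Section System.
Variables (R : realType) (m r k d : nat).

Definition output (x : R -> 'cV[R]_m.+1) (t : R) : R :=
  ((firstv R m.+1)^T *m x t) 0 0.

Section Nonlinearity.
Variables (v : R * 'cV[R]_d * 'cV[R]_k * R -> 'cV[R]_m.+1)
  (P : R * 'cV[R]_k * R -> 'M[R]_d) (w : R * 'cV[R]_k * R -> 'cV[R]_d)
  (t0 : R).
Implicit Types (y : R -> R) (lam : 'cV[R]_k * 'cV[R]_d).

Definition qsol y lam (t : R) : 'cV[R]_d :=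
  expmx (mxintegral t0 t (fun tau => P (y tau, lam.1, tau))) *m lam.2
  + mxintegral t0 t (fun tau =>
      expmx (mxintegral tau t (fun s => P (y s, lam.1, s)))
        *m w (y tau, lam.1, tau)).

(* g depends on the whole signal y on [t0, t], not only on y t. *)
Definition gfun y lam (t : R) : 'cV[R]_m.+1 :=
  v (y t, qsol y lam t, lam.1, t).

End Nonlinearity.

Variables (bb : 'cV[R]_m) (phi : R * R -> 'cV[R]_r)
  (g : (R -> R) -> 'cV[R]_k * 'cV[R]_d -> R -> 'cV[R]_m.+1) (t0 : R).

(* The right-hand side is driven by the output of x itself. *)
Definition is_solution (D : set R) (x0 : 'cV[R]_m.+1) (theta : 'cV[R]_r)
    (lam : 'cV[R]_k * 'cV[R]_d) (x : R -> 'cV[R]_m.+1) : Prop :=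
  x t0 = x0 /\
  has_derivative_on D x (fun t =>
    shiftmx R m.+1 *m x t + bvec bb *m (phi (output x t, t))^T *m theta
    + g (output x) lam t).

Variable y : R -> R.

Definition is_zsol (lam : 'cV[R]_k * 'cV[R]_d) (z : R -> 'cV[R]_m) : Prop :=
  z t0 = 0 /\
  has_derivative_on `[t0, +oo[ z (fun t =>
    Lambdamx bb *m z t + Gmx bb *m g y lam t).

Definition E0set (th : 'cV[R]_r) (lam : 'cV[R]_k * 'cV[R]_d) (T : R) :
    set ('cV[R]_r * ('cV[R]_k * 'cV[R]_d)) :=
  [set p | forall t, t0 <= t <= t0 + T ->
     bvec bb *m (phi (y t, t))^T *m (p.1 - th) + g y p.2 t - g y lam t = 0].

Section Eset.
(* Meant for z with is_zsol lam (z lam) for all lam. *)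
Variable z : 'cV[R]_k * 'cV[R]_d -> R -> 'cV[R]_m.

Definition eta (th : 'cV[R]_r) (lam : 'cV[R]_k * 'cV[R]_d) (th' : 'cV[R]_r)
    (lam' : 'cV[R]_k * 'cV[R]_d) (p : 'cV[R]_m) (t : R) : R :=
  ((phi (y t, t))^T *m (th' - th)) 0 0
  + ((firstv R m.+1)^T *m g y lam' t) 0 0
  - ((firstv R m.+1)^T *m g y lam t) 0 0
  + ((firstv R m)^T *m expmx ((t - t0) *: Lambdamx bb) *m p) 0 0
  + ((firstv R m)^T *m z lam' t) 0 0
  - ((firstv R m)^T *m z lam t) 0 0.

Definition Eset (th : 'cV[R]_r) (lam : 'cV[R]_k * 'cV[R]_d) (T : R) :
    set ('cV[R]_r * ('cV[R]_k * 'cV[R]_d)) :=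
  [set q | exists p : 'cV[R]_m,
     forall t, t0 <= t <= t0 + T -> eta th lam q.1 q.2 p t = 0].

End Eset.

Variable l : 'cV[R]_m.+1.

Definition closedloop : 'M[R]_m.+1 :=
  shiftmx R m.+1 + l *m (firstv R m.+1)^T.

Definition observer_gain : Prop :=
  exists P Q : 'M[R]_m.+1,
    [/\ posdef P, posdef Q,
        P *m closedloop + closedloop^T *m P = - Q
      & P *m bvec bb = firstv R m.+1].

Definition is_fundamental (Phi : R -> 'M[R]_(m.+1 + r)) : Prop :=
  Phi t0 = 1%:M /\
  has_derivative_on `[t0, +oo[ Phi (fun t =>
    block_mx closedloop (bvec bb *m (phi (y t, t))^T)
             (- (phi (y t, t) *m (firstv R m.+1)^T)) 0 *m Phi t).

Variable Phi : R -> 'M[R]_(m.+1 + r).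

Definition forcing (lam : 'cV[R]_k * 'cV[R]_d) (t : R) : 'cV[R]_(m.+1 + r) :=
  col_mx (g y lam t - y t *: l) (y t *: phi (y t, t)).

Definition Rvec (T : R) (lam : 'cV[R]_k * 'cV[R]_d) : 'cV[R]_(m.+1 + r) :=
  invmx (1%:M - Phi (t0 + T)) *m Phi (t0 + T)
    *m mxintegral t0 (t0 + T) (fun s => invmx (Phi s) *m forcing lam s).

Definition yhat (T : R) (lam : 'cV[R]_k * 'cV[R]_d) (t : R) : R :=
  ((firstv R (m.+1 + r))^T *m
    (Phi t *m Rvec T lam
     + Phi t *m mxintegral t0 t (fun s => invmx (Phi s) *m forcing lam s))) 0 0.

End System.

(* Main.v *)
Require Import Defs.
From HB Require Import structures.
From mathcomp Require Import all_boot all_order all_algebra.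
From mathcomp Require Import complex.
From mathcomp Require Import all_classical all_reals all_analysis.
From mathcomp Require Import ring lra.
Set Implicit Arguments.
Unset Strict Implicit.
Unset Printing Implicit Defensive.
Import Order.TTheory GRing.Theory Num.Theory.
Import numFieldNormedType.Exports.
Local Open Scope classical_set_scope.
Local Open Scope ring_scope.

(** Statement 2 forces lambda' to be the true parameter lambda, and so does
    statement 1; once lambda' = lambda, both statements and the formula for
    (x_0, theta) are read off the true trajectory.

    Identifiability. Suppose that x' has output y on [t0, t0 + T] and satisfies
    the state equation with parameters (theta', lambda'). The difference
    e = x' - x has zero first component, and G e satisfies an autonomous linear
    equation with matrix Lambda up to the difference of the filtered signals
    z(lambda') - z(lambda), because G b = 0 and G A_0 = Lambda G on vectors with
    zero first component. Reading the derivative of the first component of e,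
    which is zero, gives eta = 0, so (theta', lambda') lies in E
    (same_output_Eset). The true pair lies in E as well, and E has at most one
    element.

    Statement 2 provides such an x' with theta' = theta. Statement 1 provides
    one too: yhat is the output of the solution xi of the observer equation
    that starts at R(lambda') (variation_of_constants). When this output is y,
    the equation for the lower block of xi has right-hand side zero, so that
    block is a constant theta', and the upper block solves the state equation
    with parameters (theta', lambda') (observer_state).

    Conversely let lambda' = lambda. The vector (x, theta) solves the observer
    equation (state_observer) and is T-periodic: x(t + T) - x(t) solves
    e' = A_0 e with zero output, hence vanishes (zero_output_eq0,
    state_periodic). Evaluating the variation of constants formula at t0 + T
    yields (I - Phi(t0 + T)) (x_0, theta) = Phi(t0 + T) int Phi^-1 f, that is
    (x_0, theta) = R(lambda) once I - Phi(t0 + T) is known to be invertible;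
    then yhat is the first component of (x, theta), which is y.

    Invertibility (monodromy_unit) is a Lyapunov argument over one period. For
    a homogeneous solution (xi_1, xi_2) the function
    V = xi_1^T P xi_1 + |xi_2|^2 has derivative - xi_1^T Q xi_1. If the
    solution takes the same value at t0 and t0 + T then V is constant, so
    xi_1 = 0; therefore xi_2 is constant and phi^T xi_2 = 0, and persistency of
    excitation gives xi_2 = 0. *)

(** * One-sided differential calculus *)

Section OnesidedCalculus.
Variable R : realType.

Lemma cvg_ext (T U : Type) (F : set_system T) {FF : Filter F} (f g : T -> U)
  (G : set_system U) : f =1 g -> f @ F --> G -> g @ F --> G.
Proof. by move=> fg; rewrite (eq_cvg _ _ fg). Qed.

Lemma cvg_dnbhs_within (D : set R) t : within D t^' `=>` within D (nbhs t).
Proof. by move=> A; exact: cvg_within. Qed.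

Section NormedModule.
Variable V : normedModType R.
Implicit Types (D : set R) (X Y dX dY : R -> V).

Lemma sub_has_derivative_on D D' X dX : D' `<=` D ->
  has_derivative_on D X dX -> has_derivative_on D' X dX.
Proof.
move=> DD hX t /DD Dt; apply: cvg_trans (hX t Dt).
by apply: cvg_app; exact: within_subset.
Qed.

Lemma eq_has_derivative_on D X Y dX dY : {in D, X =1 Y} -> {in D, dX =1 dY} ->
  has_derivative_on D X dX -> has_derivative_on D Y dY.
Proof.
move=> XY dXY hX t Dt; rewrite -dXY ?inE//; apply: cvg_trans (hX t Dt).
apply: near_eq_cvg; rewrite near_withinE; near=> s => Ds.
by rewrite !XY ?inE.
Unshelve. all: by end_near. Qed.

Lemma has_derivative_on_cst D (c : V) :
  has_derivative_on D (fun=> c) (fun=> 0).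
Proof.
move=> t Dt; rewrite (_ : (fun s => _) = fun=> 0); first exact: cvg_cst.
by apply/funext => s; rewrite subrr scaler0.
Qed.

Lemma has_derivative_onD D X Y dX dY :
  has_derivative_on D X dX -> has_derivative_on D Y dY ->
  has_derivative_on D (fun t => X t + Y t) (fun t => dX t + dY t).
Proof.
move=> hX hY t Dt; apply: cvg_ext (cvgD (hX t Dt) (hY t Dt)) => s.
by rewrite /= opprD addrACA scalerDr.
Qed.

Lemma has_derivative_onN D X dX : has_derivative_on D X dX ->
  has_derivative_on D (fun t => - X t) (fun t => - dX t).
Proof.
move=> hX t Dt; apply: cvg_ext (cvgN (hX t Dt)) => s.
by rewrite /= -opprD scalerN.
Qed.

Lemma has_derivative_onB D X Y dX dY :
  has_derivative_on D X dX -> has_derivative_on D Y dY ->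
  has_derivative_on D (fun t => X t - Y t) (fun t => dX t - dY t).
Proof. by move=> hX hY; apply/has_derivative_onD/has_derivative_onN. Qed.

(** X s = X t + (s - t) q(s) where the difference quotient q converges. *)
Lemma has_derivative_on_cvg D X dX t : has_derivative_on D X dX -> D t ->
  X @ within D (nbhs t) --> X t.
Proof.
move=> hX Dt.
have id_t : s - t @[s --> within D t^'] --> (0 : R).
  rewrite -(subrr t); apply: cvgB; last exact: cvg_cst.
  by apply: cvg_trans (@cvg_id _ (nbhs t)) => A /nbhs_dnbhs; exact: cvg_within.
have : X t + (s - t) *: ((s - t)^-1 *: (X s - X t)) @[s --> within D t^'] --> X t.
  rewrite -[X in _ --> X]addr0 -[X in _ + X](scale0r (dX t)).
  by apply: cvgD; [exact: cvg_cst|apply: cvgZ => //; exact: hX].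
move=> hcvg A AXt; have {}hcvg : X s @[s --> within D t^'] --> X t.
  apply: cvg_trans hcvg; apply: near_eq_cvg.
  rewrite near_withinE; near=> s => Ds.
  by rewrite scalerA divff ?scale1r ?subrKC// subr_eq0; near: s; exact: nbhs_dnbhs_neq.
have := hcvg A AXt; rewrite /nbhs /= /within /= !near_withinE.
apply: filterS => s; have [->|st] := eqVneq s t; last by apply.
by move=> _ _; exact: nbhs_singleton.
Unshelve. all: by end_near. Qed.
End NormedModule.

Lemma has_derivative_onM (D : set R) (f g df dg : R -> R^o) :
  has_derivative_on D f df -> has_derivative_on D g dg ->
  has_derivative_on D (fun t => f t * g t) (fun t => df t * g t + f t * dg t).
Proof.
move=> hf hg t Dt.
have gt : g s @[s --> within D t^'] --> g t.
  apply: cvg_trans (has_derivative_on_cvg hg Dt).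
  by apply: cvg_app; exact: cvg_dnbhs_within.
apply: cvg_ext (cvgD (cvgM (hf t Dt) gt) (cvgM (@cvg_cst _ (f t) _ _ _) (hg t Dt))) => s.
transitivity ((s - t)^-1 * (f s - f t) * g s + f t * ((s - t)^-1 * (g s - g t))).
  by [].
by rewrite /GRing.scale/=; ring.
Qed.

Lemma cvg_sumR (T : Type) (F : set_system T) {FF : Filter F} (I : Type) (s : seq I)
    (f : I -> T -> R) (l : I -> R) :
  (forall i, f i @ F --> l i) ->
  \sum_(i <- s) f i x @[x --> F] --> \sum_(i <- s) l i.
Proof. by move=> fl; apply: cvg_big => [|i _]; [exact: add_continuous|exact: fl]. Qed.

Lemma cvg_prodR (T : Type) (F : set_system T) {FF : Filter F} (I : Type) (s : seq I)
    (f : I -> T -> R) (l : I -> R) :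
  (forall i, f i @ F --> l i) ->
  \prod_(i <- s) f i x @[x --> F] --> \prod_(i <- s) l i.
Proof. by move=> fl; apply: cvg_big => [|i _]; [exact: mul_continuous|exact: fl]. Qed.

Lemma cvg_pairT (T : Type) (F : set_system T) {FF : Filter F} (U V : topologicalType)
    (f : T -> U) (g : T -> V) (a : U) (b : V) :
  f @ F --> a -> g @ F --> b -> (f x, g x) @[x --> F] --> (a, b).
Proof. by move=> fa gb; exact: (cvg_pair fa gb). Qed.

(** Neighbourhoods of a matrix are finite products of neighbourhoods of its
    entries. *)
Lemma cvg_mxP (T : Type) (F : set_system T) {FF : Filter F} p q
    (X : T -> 'M[R]_(p, q)) (L : 'M[R]_(p, q)) :
  X @ F --> L <-> forall i j, X s i j @[s --> F] --> L i j.
Proof.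
split=> [XL i j|XL].
  exact: (@cvg_comp _ _ _ _ _ F (nbhs L) _ XL (@coord_continuous _ _ _ i j L)).
apply/filter_fromP => P LP; rewrite /= /nbhs/=.
by apply: filter_forall => i; apply: filter_forall => j; exact: XL (LP i j).
Qed.

Lemma has_derivative_on_mxP (D : set R) p q (X dX : R -> 'M[R]_(p, q)) :
  has_derivative_on D X dX <->
  forall i j, has_derivative_on D ((fun t => X t i j) : R -> R^o) (fun t => dX t i j).
Proof.
split=> [hX i j t Dt|hX t Dt].
  have /cvg_mxP := hX t Dt => /(_ i j); apply: cvg_ext => s.
  by rewrite !mxE.
apply/cvg_mxP => i j; apply: cvg_ext (hX i j t Dt) => s.
by rewrite !mxE.
Qed.

Lemma has_derivative_on_sum (D : set R) (I : Type) (r : seq I) (f df : I -> R -> R^o) :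
  (forall i, has_derivative_on D (f i) (df i)) ->
  has_derivative_on D (fun t => \sum_(i <- r) f i t) (fun t => \sum_(i <- r) df i t).
Proof.
move=> hf; elim: r => [|i r IH].
  apply: (@eq_has_derivative_on _ D (fun=> 0) _ (fun=> 0)).
  - by move=> t _; rewrite big_nil.
  - by move=> t _; rewrite big_nil.
  - exact: has_derivative_on_cst.
apply: eq_has_derivative_on (has_derivative_onD (hf i) IH) => t _;
by rewrite big_cons.
Qed.

Lemma has_derivative_on_mulmx (D : set R) p q r (X dX : R -> 'M[R]_(p, q))
    (Y dY : R -> 'M[R]_(q, r)) :
  has_derivative_on D X dX -> has_derivative_on D Y dY ->
  has_derivative_on D (fun t => X t *m Y t) (fun t => dX t *m Y t + X t *m dY t).
Proof.
move=> /has_derivative_on_mxP hX /has_derivative_on_mxP hY.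
apply/has_derivative_on_mxP => i j.
apply: eq_has_derivative_on; last first.
- apply: (@has_derivative_on_sum _ _ (index_enum 'I_q)) => k.
  exact: has_derivative_onM (hX i k) (hY k j).
- by move=> t _; rewrite !mxE -big_split.
- by move=> t _; rewrite !mxE.
Qed.

Lemma has_derivative_on_trmx (D : set R) p q (X dX : R -> 'M[R]_(p, q)) :
  has_derivative_on D X dX ->
  has_derivative_on D (fun t => (X t)^T) (fun t => (dX t)^T).
Proof.
move=> /has_derivative_on_mxP hX; apply/has_derivative_on_mxP => i j.
by apply: eq_has_derivative_on (hX j i) => t _; rewrite mxE.
Qed.

Lemma has_derivative_on_is_derive (f df : R -> R) (D : set R) t :
  has_derivative_on D (f : R -> R^o) df -> nbhs t D -> is_derive t 1 f (df t).
Proof.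
move=> hf nD; have Dt := nbhs_singleton nD.
have lim : h^-1 *: (f (h *: 1 + t) - f t) @[h --> 0^'] --> df t.
  move=> A /(hf t Dt) nA.
  have : nbhs t [set s | s != t -> A ((s - t)^-1 *: (f s - f t))].
    have {}nA : nbhs t [set s | s != t -> D s -> A ((s - t)^-1 *: (f s - f t))].
      exact: nA.
    by apply: filterS2 nA nD => s As Ds st; apply: As.
  move=> /nbhs_ballP[e e0 eA]; apply/nbhs_ballP; exists e => //= h he h0.
  have := eA (h + t); rewrite /= -subr_eq0 addrK => /(_ _ h0).
  rewrite -[h *: 1]/(h * 1) mulr1; apply.
  by move: he; rewrite -!ball_normE/= sub0r normrN opprD addrCA subrr addr0 normrN.
apply: DeriveDef; first by apply/cvg_ex; exists (df t).
exact: cvg_lim lim.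
Unshelve. all: by end_near. Qed.

Lemma is_derive_cvg (f : R -> R)  t df : is_derive t (1 : R) f df ->
  (s - t)^-1 *: (f s - f t) @[s --> t^'] --> df.
Proof.
move=> [/cvg_ex[l fl] dfE]; have {dfE} <- : l = df by rewrite -dfE; exact/esym/cvg_lim.
move=> A /fl; rewrite /= /dnbhs /within/= => /nbhs_ballP[e e0 eA].
apply/nbhs_ballP; exists e => //= s se st.
have := eA (s - t); rewrite /= subr_eq0 => /(_ _ st).
rewrite -[_ *: 1]/(_ * 1) mulr1 subrK; apply.
by move: se; rewrite -!ball_normE/= sub0r normrN distrC.
Qed.

(** The mean value theorem needs two-sided derivatives in the open interval
    only. *)
Lemma ge0_has_derivative_on_le (f df : R -> R^o) a b : a <= b ->
  has_derivative_on `[a, b] f df -> (forall t, a <= t <= b -> 0 <= df t) ->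
  f a <= f b.
Proof.
rewrite le_eqVlt => /predU1P[->//|ab] hf df0.
have [c cab fE] : exists2 c, c \in `[a, b] & f b - f a = df c * (b - a); last first.
  rewrite -subr_ge0 fE ?mulr_ge0 ?subr_ge0 ?(ltW ab)//.
  by apply: df0; rewrite in_itv in cab.
apply: MVT_segment (ltW ab) _ _.
move=> x xab; apply: has_derivative_on_is_derive hf _.
  by apply: filterS (near_in_itvoo xab) => s /subset_itv_oo_cc.
apply/subspace_continuousP => x xab.
exact: has_derivative_on_cvg hf xab.
Qed.

Lemma has_derivative_on0_eq p q (X dX : R -> 'M[R]_(p, q)) a b :
  has_derivative_on `[a, b] X dX -> (forall t, a <= t <= b -> dX t = 0) ->
  forall t, a <= t <= b -> X t = X a.
Proof.
move=> hX dX0 t /andP[at_ tb]; apply/matrixP => i j.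
have {}hX : has_derivative_on `[a, t] X dX.
  by apply: sub_has_derivative_on hX; apply: subset_itvl; rewrite bnd_simp.
have {}dX0 s : a <= s <= t -> dX s i j = 0.
  by move=> /andP[as_ st]; rewrite dX0 ?mxE// as_ (le_trans st).
have /has_derivative_on_mxP/(_ i j) hXij := hX.
apply/eqP; rewrite eq_le; apply/andP; split.
  rewrite -lerN2; apply: (ge0_has_derivative_on_le at_ (has_derivative_onN hXij)).
  by move=> s sat; rewrite dX0// oppr0.
by apply: (ge0_has_derivative_on_le at_ hXij) => s sat; rewrite dX0.
Qed.

Lemma has_derivative_on_shift (V : normedModType R) (X dX : R -> V) (a T : R) : 0 <= T ->
  has_derivative_on `[a, +oo[ X dX ->
  has_derivative_on `[a, +oo[ (fun t => X (t + T)) (fun t => dX (t + T)).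
Proof.
move=> T0 hX t; rewrite /= in_itv/= andbT => at_.
have tT : `[a, +oo[%classic (t + T) by rewrite /= in_itv/= andbT ler_wpDr.
move=> A /(hX _ tT) /nbhs_ballP[e e0 eA]; apply/nbhs_ballP; exists e => //= s se st.
rewrite in_itv/= andbT => as_.
have := eA (s + T); rewrite /= [in X in _ -> _ -> _ -> X]opprD addrACA subrr addr0; apply.
- by move: se; rewrite -!ball_normE/= opprD addrACA subrr addr0.
- by rewrite (inj_eq (addIr T)).
- by rewrite /= in_itv/= andbT ler_wpDr.
Qed.

Lemma has_derivative_on_of_is_derive (f df : R -> R) (D : set R) :
  (forall t, D t -> is_derive t (1 : R) f (df t)) ->
  has_derivative_on D (f : R -> R^o) df.
Proof.
move=> fdf t /fdf/is_derive_cvg h; apply: cvg_trans h.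
by apply: cvg_app; exact: cvg_within.
Qed.

Lemma has_derivative_on_expR (D : set R) c :
  has_derivative_on D ((fun t => expR (c * t)) : R -> R^o)
    (fun t => c * expR (c * t)).
Proof.
apply: has_derivative_on_of_is_derive => t _.
apply: is_derive_eq.
by rewrite /GRing.scale/=; ring.
Qed.

(** Gronwall's inequality in both directions of time: w exp(ct) is nondecreasing
    and w exp(-ct) is nonincreasing. *)
Lemma energy_eq0 (w dw : R -> R^o) (a b c s : R) :
  has_derivative_on `[a, b] w dw ->
  (forall t, a <= t <= b -> 0 <= w t) ->
  (forall t, a <= t <= b -> `|dw t| <= c * w t) ->
  a <= s <= b -> w s = 0 -> forall t, a <= t <= b -> w t = 0.
Proof.
move=> hw w0 dwc /andP[as_ sb] ws0 t /andP[at_ tb].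
apply/eqP; rewrite eq_le w0 ?at_// andbT.
have sub u v : a <= u -> v <= b -> `[u, v] `<=` `[a, b].
  by move=> au vb; apply: subset_itv; rewrite bnd_simp.
have [ts|st] := leP t s.
- rewrite -(pmulr_lle0 _ (expR_gt0 (c * t))).
  rewrite -[leRHS](mul0r (expR (c * s))) -ws0.
  have := has_derivative_onM hw (@has_derivative_on_expR `[a, b] c).
  move=> /(sub_has_derivative_on (sub _ _ at_ sb)) /(ge0_has_derivative_on_le ts).
  apply => r /andP[tr rs].
  have /dwc : a <= r <= b by rewrite (le_trans at_ tr) (le_trans rs sb).
  rewrite ler_norml => /andP[+ _]; have := expR_gt0 (c * r); nra.
- rewrite -(pmulr_lle0 _ (expR_gt0 (- c * t))).
  rewrite -[leRHS](mul0r (expR (- c * s))) -ws0.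
  have := has_derivative_onN (has_derivative_onM hw (@has_derivative_on_expR `[a, b] (- c))).
  move=> /(sub_has_derivative_on (sub _ _ as_ tb)) /(ge0_has_derivative_on_le (ltW st)).
  rewrite lerN2; apply => r /andP[sr rt].
  have /dwc : a <= r <= b by rewrite (le_trans as_ sr) (le_trans rt tb).
  rewrite ler_norml => /andP[_ +]; have := expR_gt0 (- c * r); nra.
Qed.

(** 2 (K (x^2 + y^2) - 2 e x y) = (K - e) (x + y)^2 + (K + e) (x - y)^2. *)
Lemma norm_cross_le (e K x y : R) : `|e| <= K ->
  `|x * (e * y) *+ 2| <= K * (x * x) + K * (y * y).
Proof.
rewrite ler_norml -subr_ge0 => /andP[+]; rewrite -(subr_ge0 e K) opprK => Kl Ku.
have := mulr_ge0 Kl (sqr_ge0 (x + y)); have := mulr_ge0 Ku (sqr_ge0 (x + y)).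
have := mulr_ge0 Kl (sqr_ge0 (x - y)); have := mulr_ge0 Ku (sqr_ge0 (x - y)).
by rewrite ler_norml mulr2n => *; apply/andP; split; lra.
Qed.

(** Uniqueness for linear equations, forward and backward in time: the energy
    w = |u|^2 satisfies |w'| <= 2 p K w. *)
Lemma linear_ode_eq0 p (A : R -> 'M[R]_p) (u : R -> 'cV[R]_p) (a b K s : R) :
  has_derivative_on `[a, b] u (fun t => A t *m u t) ->
  (forall t, a <= t <= b -> forall i j, `|A t i j| <= K) ->
  a <= s <= b -> u s = 0 -> forall t, a <= t <= b -> u t = 0.
Proof.
move=> hu AK sab us0 t tab.
pose w t := \sum_i u t i 0 * u t i 0.
pose dw t := \sum_i ((A t *m u t) i 0 * u t i 0 + u t i 0 * (A t *m u t) i 0).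
have hw : has_derivative_on `[a, b] (w : R -> R^o) dw.
  apply: has_derivative_on_sum => i.
  by apply: has_derivative_onM; move/has_derivative_on_mxP : hu => /(_ i 0).
have w_ge0 r : 0 <= w r by apply: sumr_ge0 => i _; rewrite -expr2 sqr_ge0.
have dw_le r : a <= r <= b -> `|dw r| <= (K * p%:R *+ 2) * w r.
  move=> rab; have K0 (i : 'I_p) : 0 <= K by rewrite (le_trans _ (AK r rab i i)).
  have -> : dw r = \sum_i \sum_j (u r i 0 * (A r i j * u r j 0)) *+ 2.
    apply: eq_bigr => i _; rewrite [_ * u r i 0]mulrC -mulr2n mxE mulr_sumr.
    by rewrite -sumrMnl.
  have -> : K * p%:R *+ 2 * w r =
      \sum_(i < p) \sum_(j < p) (K * (u r i 0 * u r i 0) + K * (u r j 0 * u r j 0)).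
    under [RHS]eq_bigr do rewrite big_split/= sumr_const card_ord.
    rewrite big_split/= sumr_const card_ord sumrMnl -!mulr_sumr -/(w r).
    by rewrite -[X in X + _]mulr_natr -mulr_natr mulr2n; ring.
  apply: le_trans (ler_norm_sum _ _ _) _; apply: ler_sum => i _.
  apply: le_trans (ler_norm_sum _ _ _) _; apply: ler_sum => j _.
  exact: norm_cross_le (AK r rab i j).
have wt0 : w t = 0.
  apply: (energy_eq0 hw _ dw_le sab _ tab) => //.
  by rewrite /w us0 big1// => i _; rewrite mxE mul0r.
apply/colP => i; rewrite mxE; apply/eqP; rewrite -sqrf_eq0 expr2.
move/eqP: wt0; rewrite psumr_eq0; last by move=> j _; rewrite -expr2 sqr_ge0.
by move=> /allP/(_ i); rewrite mem_index_enum => /(_ isT).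
Qed.

(** Extending a function on [a, +oo[ by the constant f a keeps it continuous and
    leaves its integrals over subintervals of [a, +oo[ unchanged; this is how
    two-sided results of integration theory apply at the endpoint a. *)
Lemma continuous_max_within (U : topologicalType) (f : R -> U) a :
  {within `[a, +oo[, continuous f} -> continuous (fun t => f (Num.max a t)).
Proof.
move=> /subspace_continuousP fc t.
have mt r : `[a, +oo[%classic (Num.max a r) by rewrite /= in_itv/= le_max lexx.
apply: (@cvg_comp _ _ _ (Num.max a) f _ (within `[a, +oo[ (nbhs (Num.max a t)))).
  move=> A; rewrite /within/= => nA.
  have mc : {for t, continuous (Num.max a)}.
    by apply: continuous_max; [exact: cst_continuous|exact: cvg_id].
  have h : nbhs t [set s | `[a, +oo[%classic (Num.max a s) -> A (Num.max a s)].
    exact: (mc [set s | `[a, +oo[%classic s -> A s] nA).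
  by apply: filterS h => s; apply; exact: mt.
exact: fc.
Qed.

(** The integral of the extended function is taken from a - 1, which makes a an
    interior point. *)
Lemma has_derivative_on_integral (f : R -> R) a :
  {within `[a, +oo[, continuous f} ->
  has_derivative_on `[a, +oo[
    ((fun t => \int[lebesgue_measure]_(s in `[a, t]) f s) : R -> R^o) f.
Proof.
move=> fc; pose g s := f (Num.max a s).
have gc : continuous g := continuous_max_within fc.
have gi u v : lebesgue_measure.-integrable `[u, v] (EFin \o g).
  apply: continuous_compact_integrable; first exact: segment_compact.
  exact: continuous_subspaceT.
pose G t := \int[lebesgue_measure]_(s in `[a - 1, t]) g s.
have GE t : a <= t -> G t - G a = \int[lebesgue_measure]_(s in `[a, t]) f s.
  move=> at_; rewrite /G Rintegral_itvB ?bnd_simp//; last by rewrite lerBlDr lerDl.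
  rewrite Rintegral_itv_obnd_cbnd.
    apply: eq_Rintegral => s; rewrite inE/= in_itv/= => /andP[as_ _].
    by rewrite /g max_r.
  apply: integrableS (gi a t) => //; apply: subset_itvr; by rewrite bnd_simp.
move=> t; rewrite /= in_itv/= andbT => at_.
have dG : is_derive t (1 : R) G (f t).
  have [||d dE] := @continuous_FTC1_closed R g (a - 1) t (t + 1) _ (gi _ _) _ (gc t).
  - by rewrite ltrDl.
  - by rewrite ltrBlDr (le_lt_trans at_)// ltrDl.
  - by apply: DeriveDef => //; rewrite -derive1E dE /g max_r.
have dGw : (s - t)^-1 *: (G s - G t) @[s --> within `[a, +oo[ t^'] --> f t.
  by apply: cvg_trans (is_derive_cvg dG); apply: cvg_app; exact: cvg_within.
apply: cvg_trans dGw; apply: near_eq_cvg; rewrite near_withinE; near=> s.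
by rewrite /= in_itv/= andbT => as_; rewrite -!GE// opprB addrA subrK.
Unshelve. all: by end_near. Qed.

Lemma has_derivative_on_mxintegral p q (F : R -> 'M[R]_(p, q)) a :
  {within `[a, +oo[, continuous F} ->
  has_derivative_on `[a, +oo[ (mxintegral a ^~ F) F.
Proof.
move=> /subspace_continuousP Fc; apply/has_derivative_on_mxP => i j.
apply: (eq_has_derivative_on (X := fun t => \int[lebesgue_measure]_(s in `[a, t]) F s i j)
   (dX := fun t => F t i j)).
- by move=> t _; rewrite mxE.
- by [].
apply: has_derivative_on_integral; apply/subspace_continuousP => t Dt.
by have /cvg_mxP := Fc t Dt; exact.
Qed.

(** * The matrix exponential *)

Lemma within_continuous_bounded (f : R -> R) a b :
  {within `[a, b], continuous f} ->
  exists B, forall t, a <= t <= b -> `|f t| <= B.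
Proof.
move=> fc; have [ab|ba] := leP a b; last first.
  by exists 0 => t /andP[at_ tb]; have := le_trans at_ tb; rewrite leNgt ba.
have [c cab cmax] : exists2 c, c \in `[a, b] &
    forall t, t \in `[a, b] -> `|f t| <= `|f c|.
  apply: (EVT_max (f := fun t => `|f t|) ab).
  apply/subspace_continuousP => t tab; apply: cvg_norm.
  by move/subspace_continuousP : fc; exact.
by exists `|f c| => t tab; apply: cmax; rewrite in_itv.
Qed.

Lemma mx_within_continuous_bounded p q (F : R -> 'M[R]_(p, q)) a b :
  {within `[a, b], continuous F} ->
  exists B, forall t, a <= t <= b -> forall i j, `|F t i j| <= B.
Proof.
move=> /subspace_continuousP Fc.
have /choice[B FB] (ij : 'I_p * 'I_q) :
    exists B, forall t, a <= t <= b -> `|F t ij.1 ij.2| <= B.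
  apply: within_continuous_bounded; apply/subspace_continuousP => t tab.
  by have /cvg_mxP := Fc t tab; exact.
exists (\sum_ij `|B ij|) => t tab i j.
rewrite (le_trans (FB (i, j) t tab))// (bigD1 (i, j))//=.
rewrite (le_trans (ler_norm _))// lerDl; exact: sumr_ge0.
Qed.

Definition entry_sum p (A : 'M[R]_p) : R := \sum_i \sum_j `|A i j|.

Lemma entry_sum_ge0 p (A : 'M[R]_p) : 0 <= entry_sum A.
Proof. by apply: sumr_ge0 => ? _; apply: sumr_ge0. Qed.

Lemma row_le_entry_sum p (A : 'M[R]_p) k : \sum_l `|A k l| <= entry_sum A.
Proof.
rewrite /entry_sum [leRHS](bigD1 k)//= lerDl.
by apply: sumr_ge0 => ? _; apply: sumr_ge0.
Qed.

Lemma exprmx_entry_le p (A : 'M[R]_p) n i j :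
  `|(A ^+ n) i j| <= entry_sum A ^+ n.
Proof.
set c := entry_sum A.
have row_le := row_le_entry_sum A.
elim: n i j => [|n IH] i j.
  by rewrite !expr0 mxE; case: (i == j); rewrite ?normr1 ?normr0.
rewrite !exprS mxE (le_trans (ler_norm_sum _ _ _))//.
apply: (@le_trans _ _ (\sum_k `|A i k| * c ^+ n)).
  by apply: ler_sum => k _; rewrite normrM ler_wpM2l.
by rewrite -mulr_suml ler_wpM2r// exprn_ge0// entry_sum_ge0.
Qed.

(** Entrywise comparison with the scalar exponential series of the sum of the
    absolute values of the entries. *)
Lemma expmx_cvg p (A : 'M[R]_p) :
  series (fun i : nat => (i`!%:R)^-1 *: A ^+ i) @ \oo --> expmx A.
Proof.
pose e i j n := (n`!%:R)^-1 * (A ^+ n) i j.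
have serE n i j : (series (fun i : nat => (i`!%:R)^-1 *: A ^+ i) n) i j = series (e i j) n.
  by rewrite /series/= summxE; apply: eq_bigr => k _; rewrite mxE.
have ce i j : cvgn (series (e i j)).
  apply: normed_cvg; apply: (@series_le_cvg _ _ (exp_coeff (entry_sum A))).
  - by move=> n /=.
  - by move=> n; exact/exp_coeff_ge0/entry_sum_ge0.
  - move=> n; rewrite /e /exp_coeff/= normrM [leLHS]mulrC [`|n`!%:R^-1|]ger0_norm ?invr_ge0//.
    by rewrite ler_wpM2r ?exprmx_entry_le ?invr_ge0.
  - exact: is_cvg_series_exp_coeff.
have cL : series (fun i : nat => (i`!%:R)^-1 *: A ^+ i) @ \oo -->
    \matrix_(i, j) limn (series (e i j)).
  apply/cvg_mxP => i j; rewrite mxE; apply: cvg_ext (ce i j) => n.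
  by rewrite serE.
by rewrite /expmx (cvg_lim _ cL).
Qed.

Lemma exprmx_diag p (A : 'M[R]_p) n i j : is_diag_mx A ->
  (A ^+ n) i j = A i i ^+ n *+ (i == j).
Proof.
move=> /is_diag_mxP dA; elim: n i j => [|n IH] i j; first by rewrite !expr0 mxE.
rewrite exprS mxE (bigD1 i)//= big1 ?addr0 => [|k ki].
  by rewrite IH exprS mulrnAr.
by rewrite dA ?mul0r// eq_sym.
Qed.

Lemma expmx_diag p (A : 'M[R]_p) i j : is_diag_mx A ->
  expmx A i j = expR (A i i) *+ (i == j).
Proof.
move=> dA; have /cvg_mxP/(_ i j) := @expmx_cvg _ A.
move=> /(cvg_lim (@Rhausdorff R)) <-; case: eqVneq => [<-|ij]; rewrite ?mulr1n ?mulr0n.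
  rewrite /expR; congr (limn _); apply/funext => n.
  rewrite /series/= summxE; apply: eq_bigr => k _.
  by rewrite mxE exprmx_diag// eqxx mulr1n mulrC.
rewrite (_ : (fun _ => _) = fun=> 0) ?lim_cst//; apply/funext => n.
rewrite /series/= summxE big1// => k _.
by rewrite mxE exprmx_diag// (negbTE ij) mulr0n mulr0.
Qed.

Lemma has_derivative_on_Zl p q (D : set R) (c dc : R -> R^o) (M : 'M[R]_(p, q)) :
  has_derivative_on D c dc ->
  has_derivative_on D (fun t => c t *: M) (fun t => dc t *: M).
Proof.
move=> hc; apply/has_derivative_on_mxP => i j.
apply: eq_has_derivative_on (has_derivative_onM hc (@has_derivative_on_cst _ D (M i j : R^o))).
  by move=> t _; rewrite mxE.
by move=> t _; rewrite mxE mulr0 addr0.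
Qed.

Lemma has_derivative_on_powfact (D : set R) (a : R) n :
  has_derivative_on D ((fun t => (t - a) ^+ n.+1 / n.+1`!%:R) : R -> R^o)
    (fun t => (t - a) ^+ n / n`!%:R).
Proof.
have pw : has_derivative_on D ((fun t => (t - a) ^+ n.+1) : R -> R^o)
    (fun t => n.+1%:R * (t - a) ^+ n).
  elim: n => [|n IH].
    apply: has_derivative_on_of_is_derive => t _; apply: is_derive_eq.
    by rewrite subr0 mulr1.
  have h1 : has_derivative_on D ((fun t => t - a) : R -> R^o) (fun=> 1).
    apply: has_derivative_on_of_is_derive => t _; apply: is_derive_eq.
    by rewrite subr0.
  apply: eq_has_derivative_on (has_derivative_onM h1 IH) => t _.
    by rewrite -exprS.
  by rewrite mul1r mulrCA -exprS -[X in X + _]mul1r -mulrDl addrC natr1.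
apply: eq_has_derivative_on (has_derivative_onM pw
  (@has_derivative_on_cst _ D (n.+1`!%:R^-1 : R^o))) => t _ //.
rewrite mulr0 addr0 factS natrM invfM mulrACA mulrA divff ?pnatr_eq0//.
by rewrite mul1r.
Qed.

(** The N-th Taylor polynomial at a of the solution of u' = A u, u(a) = v. *)
Definition exp_partial p (A : 'M[R]_p) (v : 'cV[R]_p) (a : R) N t : 'cV[R]_p :=
  \sum_(i < N) ((t - a) ^+ i / i`!%:R) *: (A ^+ i *m v).

Lemma has_derivative_on_exp_partial p (A : 'M[R]_p) v a N (D : set R) :
  has_derivative_on D (exp_partial A v a N.+1) (fun t => A *m exp_partial A v a N t).
Proof.
elim: N => [|N IH].
  apply: (@eq_has_derivative_on _ D (fun=> v) _ (fun=> 0)).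
  - by move=> t _; rewrite /exp_partial big_ord1 !expr0 mul1mx divr1 scale1r.
  - by move=> t _; rewrite /exp_partial big_ord0 mulmx0.
  - exact: has_derivative_on_cst.
have h := has_derivative_onD IH (has_derivative_on_Zl (M := A ^+ N.+1 *m v)
  (@has_derivative_on_powfact D a N)).
apply: eq_has_derivative_on h => t _; first by rewrite [RHS]big_ord_recr.
rewrite {2}/exp_partial big_ord_recr/= -/(exp_partial _ _ _ _ _) mulmxDr -scalemxAr.
by rewrite mulmxA exprS.
Qed.

Lemma exprZmx p (c : R) (A : 'M[R]_p) n : (c *: A) ^+ n = c ^+ n *: A ^+ n.
Proof.
elim: n => [|n IH]; first by rewrite !expr0 scale1r.
have mulE (X Y : 'M[R]_p) : X * Y = X *m Y by [].
by rewrite !exprS IH !mulE -scalemxAl -scalemxAr scalerA.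
Qed.

Lemma exp_partialE p (A : 'M[R]_p) v a N t :
  exp_partial A v a N t = series (fun i : nat => (i`!%:R)^-1 *: ((t - a) *: A) ^+ i) N *m v.
Proof.
rewrite /series/= big_mkord mulmx_suml; apply: eq_bigr => i _.
by rewrite exprZmx scalerA mulrC scalemxAl.
Qed.

(** The remainders r_N = u - exp_partial N satisfy r_(N+1)' = A r_N and
    r_(N+1)(a) = 0. By induction their entries are at most
    B c^N (t - a)^N / N!, where B bounds u, and so tend to 0. *)
Lemma linear_ode_expmx p (A : 'M[R]_p) (u : R -> 'cV[R]_p) (a b : R) :
  has_derivative_on `[a, b] u (fun t => A *m u t) ->
  forall t, a <= t <= b -> u t = expmx ((t - a) *: A) *m u a.
Proof.
move=> hu.
have [B uB] : exists B, forall t, a <= t <= b -> forall i j, `|u t i j| <= B.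
  apply: mx_within_continuous_bounded; apply/subspace_continuousP => t tab.
  exact: has_derivative_on_cvg hu tab.
pose c := entry_sum A; have row_le := row_le_entry_sum A.
have bnd N t : a <= t <= b -> forall i,
    `|u t i 0 - exp_partial A (u a) a N t i 0| <= B * c ^+ N * ((t - a) ^+ N / N`!%:R).
  elim: N t => [|N IH] t tab i.
    by rewrite /exp_partial big_ord0 mxE subr0 !expr0 divr1 !mulr1 uB.
  have /andP[at_ tb] := tab.
  pose f s : R := u s i 0 - exp_partial A (u a) a N.+1 s i 0.
  pose df s : R := (A *m u s) i 0 - (A *m exp_partial A (u a) a N s) i 0.
  pose g s : R := B * c ^+ N.+1 * ((s - a) ^+ N.+1 / N.+1`!%:R).
  pose dg s : R := 0 * ((s - a) ^+ N.+1 / N.+1`!%:R) + B * c ^+ N.+1 * ((s - a) ^+ N / N`!%:R).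
  have sub : `[a, t] `<=` `[a, b] by apply: subset_itvl; rewrite bnd_simp.
  have hf : has_derivative_on `[a, t] (f : R -> R^o) df.
    have := @has_derivative_on_exp_partial p A (u a) a N `[a, t].
    move=> /has_derivative_on_mxP/(_ i 0).
    by move: (sub_has_derivative_on sub hu) => /has_derivative_on_mxP/(_ i 0)/has_derivative_onB; apply.
  have hg : has_derivative_on `[a, t] (g : R -> R^o) dg.
    apply: has_derivative_onM; first exact: has_derivative_on_cst.
    exact: has_derivative_on_powfact.
  have dfg s : a <= s <= t -> `|df s| <= dg s.
    move=> /andP[as_ st]; have sab : a <= s <= b by rewrite as_ (le_trans st).
    have -> : df s = \sum_k A i k * (u s k 0 - exp_partial A (u a) a N s k 0).
      by rewrite /df !mxE -sumrB; apply: eq_bigr => k _; rewrite mulrBr.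
    rewrite (le_trans (ler_norm_sum _ _ _))//.
    apply: (@le_trans _ _ (\sum_k `|A i k| * (B * c ^+ N * ((s - a) ^+ N / N`!%:R)))).
      by apply: ler_sum => k _; rewrite normrM ler_wpM2l// IH.
    have nn := le_trans (normr_ge0 _) (IH s sab i).
    have -> : dg s = c * (B * c ^+ N * ((s - a) ^+ N / N`!%:R)).
      by rewrite /dg mul0r add0r exprS -!mulrA [B * (c * _)]mulrCA.
    by rewrite -mulr_suml ler_wpM2r.
  have fa : f a = 0.
    rewrite /f /exp_partial big_ord_recl/= expr0 divr1 scale1r mul1mx mxE summxE big1 ?addr0 ?subrr//.
    by move=> k _; rewrite expr0n/= mul0r scale0r mxE.
  have ga : g a = 0 by rewrite /g subrr expr0n/= mul0r mulr0.
  rewrite -[X in `|X|]/(f t) -[leRHS]/(g t) ler_norml; apply/andP; split.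
    have := ge0_has_derivative_on_le at_ (has_derivative_onD hg hf).
    rewrite /= fa ga addr0 -lerBlDl sub0r; apply => s /dfg.
    by rewrite ler_norml => /andP[h _]; rewrite -lerBlDl sub0r.
  have := ge0_has_derivative_on_le at_ (has_derivative_onB hg hf).
  rewrite /= fa ga subr0 subr_ge0; apply => s /dfg.
  by rewrite ler_norml => /andP[_]; rewrite -subr_ge0.
move=> t tab.
have c1 : exp_partial A (u a) a ^~ t @ \oo --> expmx ((t - a) *: A) *m u a.
  apply/cvg_mxP => i j; rewrite mxE.
  have h : (fun N => \sum_k (series (fun i : nat => (i`!%:R)^-1 *: ((t - a) *: A) ^+ i) N) i k * u a k j)
      @ \oo --> \sum_k expmx ((t - a) *: A) i k * u a k j.
    apply: cvg_sumR => k; apply: cvgMl; by have /cvg_mxP := @expmx_cvg _ ((t - a) *: A); exact.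
  by apply: cvg_ext h => N; rewrite exp_partialE mxE.
have c2 : exp_partial A (u a) a ^~ t @ \oo --> u t.
  apply/cvg_mxP => i j; rewrite (ord1 j).
  have : B * exp_coeff (c * (t - a)) N @[N --> \oo] --> (0 : R).
    by rewrite -(mulr0 B); apply: cvgMr; exact: cvg_exp_coeff.
  move=> /cvgrPdist_le h; apply/cvgrPdist_le => e e0.
  near=> N; rewrite (le_trans (bnd N t tab i))//.
  have : `|0 - B * exp_coeff (c * (t - a)) N| <= e by near: N; exact: h.
  rewrite sub0r normrN; apply: le_trans; rewrite /exp_coeff/= exprMn.
  by rewrite (le_trans _ (ler_norm _))// !mulrA.
exact: (cvg_unique _ c2 c1).
Unshelve. all: by end_near. Qed.

(** * Regularity of the known nonlinearity *)

Lemma eq_mxintegral p q (a b : R) (F G : R -> 'M[R]_(p, q)) :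
  (forall s, a <= s <= b -> F s = G s) -> mxintegral a b F = mxintegral a b G.
Proof.
move=> FG; apply/matrixP => i j; rewrite !mxE; apply: eq_Rintegral => s.
by rewrite inE/= in_itv/= => /FG ->.
Qed.

Lemma mxintegral_same p q (a : R) (F : R -> 'M[R]_(p, q)) : mxintegral a a F = 0.
Proof. by apply/matrixP => i j; rewrite !mxE set_itv1 Rintegral_set1. Qed.

Lemma within_continuous_integrable (f : R -> R) (a b : R) :
  {within `[a, +oo[, continuous f} ->
  lebesgue_measure.-integrable `[a, b] (EFin \o f).
Proof.
move=> fc; apply: continuous_compact_integrable; first exact: segment_compact.
by apply: continuous_subspaceW fc; exact: subset_itvl.
Qed.

Lemma has_derivative_on_within_continuous (V : normedModType R) (D : set R) (X dX : R -> V) :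
  has_derivative_on D X dX -> {within D, continuous X}.
Proof.
move=> hX; apply/subspace_continuousP => t; exact: has_derivative_on_cvg hX.
Qed.

Lemma expmx_diag_mulmx p (A : 'M[R]_p) (u : 'cV[R]_p) i : is_diag_mx A ->
  (expmx A *m u) i 0 = expR (A i i) * u i 0.
Proof.
move=> dA; rewrite mxE (bigD1 i)//= big1 ?addr0 => [|k ki].
  by rewrite expmx_diag// eqxx.
by rewrite expmx_diag// eq_sym (negbTE ki) mul0r.
Qed.

Section SignalDependence.
Variables (m k d : nat).
Variables (v : R * 'cV[R]_d * 'cV[R]_k * R -> 'cV[R]_m.+1)
  (P : R * 'cV[R]_k * R -> 'M[R]_d) (w : R * 'cV[R]_k * R -> 'cV[R]_d) (t0 : R).

(** gfun is causal: its value at t only involves the signal on [t0, t]. *)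
Lemma eq_gfun (y1 y2 : R -> R) lam t : t0 <= t ->
  (forall s, t0 <= s <= t -> y1 s = y2 s) ->
  gfun v P w t0 y1 lam t = gfun v P w t0 y2 lam t.
Proof.
move=> t0t y12; rewrite /gfun (y12 t) ?t0t ?lexx//.
have PE s : t0 <= s -> mxintegral s t (fun r => P (y1 r, lam.1, r)) =
    mxintegral s t (fun r => P (y2 r, lam.1, r)).
  move=> t0s; apply: eq_mxintegral => r /andP[sr rt].
  by rewrite y12// rt (le_trans t0s).
have qE : qsol P w t0 y1 lam t = qsol P w t0 y2 lam t.
  rewrite /qsol PE//; apply: (congr1 (fun z => _ + z)).
  apply: eq_mxintegral => s /andP[t0s st].
  by rewrite (PE _ t0s) (y12 s); [reflexivity|rewrite t0s].
by rewrite qE.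
Qed.

Hypotheses (v_cont : continuous v) (P_cont : continuous P) (w_cont : continuous w).
Hypothesis P_diag : forall u, is_diag_mx (P u).
Variable y : R -> R.
Hypothesis y_cont : {within `[t0, +oo[, continuous y}.
Implicit Type lam : 'cV[R]_k * 'cV[R]_d.

Let signal_cvg (mu : 'cV[R]_k) (t : R) : `[t0, +oo[%classic t ->
  (y s, mu, s) @[s --> within `[t0, +oo[ (nbhs t)] --> (y t, mu, t).
Proof.
move=> Dt; apply: cvg_pairT; last exact: cvg_within.
apply: cvg_pairT; last exact: cvg_cst.
by move/subspace_continuousP: y_cont; exact.
Qed.

Let P_cvg (mu : 'cV[R]_k) i j :
  {within `[t0, +oo[, continuous (fun s => P (y s, mu, s) i j)}.
Proof.
apply/subspace_continuousP => t Dt.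
have /cvg_mxP : P (y s, mu, s) @[s --> within `[t0, +oo[ (nbhs t)] --> P (y t, mu, t).
  by apply: continuous_cvg; [exact: P_cont|exact: signal_cvg].
exact.
Qed.

Let w_cvg (mu : 'cV[R]_k) i j :
  {within `[t0, +oo[, continuous (fun s => w (y s, mu, s) i j)}.
Proof.
apply/subspace_continuousP => t Dt.
have /cvg_mxP : w (y s, mu, s) @[s --> within `[t0, +oo[ (nbhs t)] --> w (y t, mu, t).
  by apply: continuous_cvg; [exact: w_cont|exact: signal_cvg].
exact.
Qed.

Let I (mu : 'cV[R]_k) (i : 'I_d) (s : R) := \int[lebesgue_measure]_(r in `[t0, s]) P (y r, mu, r) i i.

Let I_cont mu i : {within `[t0, +oo[, continuous (I mu i)}.
Proof.
exact: has_derivative_on_within_continuous (has_derivative_on_integral (@P_cvg mu i i)).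
Qed.

Let J (mu : 'cV[R]_k) (i : 'I_d) (s : R) :=
  \int[lebesgue_measure]_(r in `[t0, s]) (expR (- I mu i r) * w (y r, mu, r) i 0).

Let J_integrand_cont mu i :
  {within `[t0, +oo[, continuous (fun r => expR (- I mu i r) * w (y r, mu, r) i 0)}.
Proof.
apply/subspace_continuousP => t Dt; apply: cvgM.
  apply: continuous_cvg; first exact: continuous_expR.
  by apply: cvgN; have /subspace_continuousP := @I_cont mu i; exact.
by have /subspace_continuousP := @w_cvg mu i 0; exact.
Qed.

Let J_cont mu i : {within `[t0, +oo[, continuous (J mu i)}.
Proof.
exact: has_derivative_on_within_continuous
  (has_derivative_on_integral (@J_integrand_cont _ _)).
Qed.

(** For diagonal P the integral from s to t in the exponent splits as I t - I s,
    which separates the dependence on t from the inner variable of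
    integration. *)
Lemma qsolE lam t i : t0 <= t ->
  qsol P w t0 y lam t i 0 = expR (I lam.1 i t) * (lam.2 i 0 + J lam.1 i t).
Proof.
move=> t0t.
have Idiff s : t0 <= s <= t ->
    \int[lebesgue_measure]_(r in `[s, t]) P (y r, lam.1, r) i i = I lam.1 i t - I lam.1 i s.
  move=> /andP[t0s st]; rewrite /I Rintegral_itvB ?bnd_simp//; last first.
    exact: (within_continuous_integrable _ (@P_cvg _ _ _)).
  rewrite Rintegral_itv_obnd_cbnd//.
  apply: integrableS (within_continuous_integrable t (@P_cvg _ _ _)) => //.
  by apply: subset_itvr; rewrite bnd_simp.
have diag s : is_diag_mx (mxintegral s t (fun r => P (y r, lam.1, r))).
  apply/is_diag_mxP => a b ab; rewrite mxE.
  rewrite (@eq_Rintegral _ _ _ _ _ (fun=> 0)); last first.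
    by move=> r _; have /is_diag_mxP := P_diag (y r, lam.1, r); apply.
  by rewrite Rintegral_cst//= mul0r.
rewrite /qsol mxE expmx_diag_mulmx// [X in expR X]mxE mulrDr; congr (_ + _).
rewrite mxE -RintegralZl//; last exact: (within_continuous_integrable _ (@J_integrand_cont _ _)).
apply: eq_Rintegral => s; rewrite inE/= in_itv/= => st.
by rewrite expmx_diag_mulmx// [X in expR X]mxE (Idiff _ st) expRD mulrA.
Qed.

Lemma gfun_continuous lam : {within `[t0, +oo[, continuous (gfun v P w t0 y lam)}.
Proof.
apply/subspace_continuousP => t Dt.
have t0t : t0 <= t by move: Dt; rewrite /= in_itv/= andbT.
have qc : qsol P w t0 y lam s @[s --> within `[t0, +oo[ (nbhs t)] --> qsol P w t0 y lam t.
  apply/cvg_mxP => i j; rewrite (ord1 j).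
  suff /subspace_continuousP :
      {within `[t0, +oo[, continuous (fun s => qsol P w t0 y lam s i 0)} by exact.
  apply: (@subspace_eq_continuous _ _ _
      (fun s => expR (I lam.1 i s) * (lam.2 i 0 + J lam.1 i s))) => [s|].
    by rewrite inE/= in_itv/= andbT => t0s; apply/esym; exact: qsolE.
  apply/subspace_continuousP => s Ds; apply: cvgM.
    apply: continuous_cvg; first exact: continuous_expR.
    by have /subspace_continuousP := @I_cont lam.1 i; exact.
  apply: cvgD; first exact: cvg_cst.
  by have /subspace_continuousP := @J_cont lam.1 i; exact.
suff : v (y s, qsol P w t0 y lam s, lam.1, s) @[s --> within `[t0, +oo[ (nbhs t)]
    --> v (y t, qsol P w t0 y lam t, lam.1, t) by exact.
have arg : (y s, qsol P w t0 y lam s, lam.1, s) @[s --> within `[t0, +oo[ (nbhs t)]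
    --> (y t, qsol P w t0 y lam t, lam.1, t).
  apply: cvg_pairT; last exact: cvg_within.
  apply: cvg_pairT; last exact: cvg_cst.
  apply: cvg_pairT; last exact: qc.
  by move/subspace_continuousP: y_cont; exact.
by apply: continuous_cvg arg; exact: v_cont.
Qed.

End SignalDependence.

(** * Convergence of determinants and inverses *)

Lemma cvg_det (T : Type) (F : set_system T) {FF : Filter F} p
    (X : T -> 'M[R]_p) (L : 'M[R]_p) :
  X @ F --> L -> \det (X x) @[x --> F] --> \det L.
Proof.
move=> /cvg_mxP XL; apply: cvg_sumR => s.
by apply: cvgMr; apply: cvg_prodR => i; exact: XL.
Qed.

Lemma cvg_invmx (T : Type) (F : set_system T) {FF : Filter F} p
    (X : T -> 'M[R]_p) (L : 'M[R]_p) : L \in unitmx ->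
  (\forall x \near F, X x \in unitmx) ->
  X @ F --> L -> invmx (X x) @[x --> F] --> invmx L.
Proof.
move=> Lu Xu XL.
have : (\det (X x))^-1 *: \adj (X x) @[x --> F] --> invmx L.
  rewrite /invmx Lu; apply: cvgZ.
    by apply: cvgV; [rewrite -unitfE -unitmxE|exact: cvg_det].
  apply/cvg_mxP => i j; rewrite mxE.
  have h : cofactor (X x) j i @[x --> F] --> cofactor L j i.
    apply: cvgMr; apply: cvg_det; apply/cvg_mxP => a b; rewrite !mxE.
    have h : X x (lift j a) (lift i b) @[x --> F] --> L (lift j a) (lift i b).
      by move/cvg_mxP: XL; exact.
    by apply: cvg_ext h => x; rewrite !mxE.
  by apply: cvg_ext h => x; rewrite mxE.
apply: cvg_trans; apply: near_eq_cvg; apply: filterS Xu => x Xx.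
by rewrite /invmx Xx.
Qed.

Lemma unitmx_ker0 p (A : 'M[R]_p) :
  (forall c : 'cV[R]_p, A *m c = 0 -> c = 0) -> A \in unitmx.
Proof.
move=> kA; rewrite -unitmx_tr -row_free_unit; apply: inj_row_free => u uA.
by rewrite -[u]trmxK (kA u^T) ?trmx0// -[LHS]trmxK trmx_mul trmxK uA trmx0.
Qed.

End OnesidedCalculus.
(** * Matrix calculus *)

Section MatrixCalculus.
Variable R : realType.

(** Every point of a nondegenerate segment, endpoints included, is a limit of
    other points of the segment, so that one-sided derivatives are unique. *)
Lemma within_dnbhs_proper (a b t : R) : a < b -> a <= t <= b ->
  ProperFilter (within `[a, b] t^').
Proof.
move=> ab /andP[at_ tb]; apply: Build_ProperFilter_ex => A /nbhs_ballP[e /= e0 eA].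
have [tb'|bt] := ltP t b.
  pose h := Num.min (e / 2) (b - t).
  have h0 : 0 < h by rewrite lt_min divr_gt0//= subr_gt0.
  have hb : h <= b - t by rewrite ge_min lexx orbT.
  have he : h < e by rewrite gt_min ltr_pdivrMr// ltr_pMr// ltr1n.
  exists (t + h); apply: eA.
  - by rewrite -ball_normE/= opprD addrA subrr sub0r normrN gtr0_norm.
  - by rewrite -subr_eq0 addrAC subrr add0r gt_eqF.
  - by rewrite in_itv/= ler_wpDr ?(ltW h0)//= -lerBrDl.
have {bt} tb' : t = b by apply/le_anti/andP.
pose h := Num.min (e / 2) (b - a).
have h0 : 0 < h by rewrite lt_min divr_gt0//= subr_gt0.
have hb : h <= b - a by rewrite ge_min lexx orbT.
have he : h < e by rewrite gt_min ltr_pdivrMr// ltr_pMr// ltr1n.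
exists (t - h); apply: eA.
- by rewrite -ball_normE/= opprB addrC subrK gtr0_norm.
- by rewrite -subr_eq0 addrAC subrr add0r oppr_eq0 gt_eqF.
- by rewrite in_itv/= tb' lerBlDr ler_wpDr ?(ltW h0)// andbT lerBrDl -lerBrDr.
Qed.

Lemma has_derivative_on_zero p q (X dX : R -> 'M[R]_(p, q)) (a b : R) : a < b ->
  has_derivative_on `[a, b] X dX -> (forall t, a <= t <= b -> X t = 0) ->
  forall t, a <= t <= b -> dX t = 0.
Proof.
move=> ab /has_derivative_on_mxP hX X0 t tab; apply/matrixP => i j; rewrite [RHS]mxE.
have FF := within_dnbhs_proper ab tab.
have Dt : `[a, b]%classic t by rewrite /= in_itv.
have h0 : (s - t)^-1 *: (X s i j - X t i j) @[s --> within `[a, b] t^'] --> (0 : R).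
  rewrite (_ : nbhs 0 = nbhs ((fun=> 0) t)) //.
  apply: cvg_trans (@cvg_cst _ (0 : R) _ (within `[a, b] t^') _).
  apply: near_eq_cvg; rewrite near_withinE; near=> s.
  by rewrite /= in_itv/= => sab; rewrite !X0// !mxE subrr scaler0.
exact: (cvg_unique (@Rhausdorff R) (hX i j t Dt) h0).
Unshelve. all: by end_near. Qed.

Lemma has_derivative_on_mulmxl p q r (D : set R) (M : 'M[R]_(p, q))
    (X dX : R -> 'M[R]_(q, r)) : has_derivative_on D X dX ->
  has_derivative_on D (fun t => M *m X t) (fun t => M *m dX t).
Proof.
move=> hX.
have h := has_derivative_on_mulmx (@has_derivative_on_cst _ _ D M) hX.
by apply: eq_has_derivative_on h => t _ //; rewrite mul0mx add0r.
Qed.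

Lemma has_derivative_on_mulmxr p q r (D : set R) (M : 'M[R]_(q, r))
    (X dX : R -> 'M[R]_(p, q)) : has_derivative_on D X dX ->
  has_derivative_on D (fun t => X t *m M) (fun t => dX t *m M).
Proof.
move=> hX.
have h := has_derivative_on_mulmx hX (@has_derivative_on_cst _ _ D M).
by apply: eq_has_derivative_on h => t _ //; rewrite mulmx0 addr0.
Qed.

Lemma has_derivative_on_col_mx p q r (D : set R) (X dX : R -> 'M[R]_(p, r))
    (Y dY : R -> 'M[R]_(q, r)) :
  has_derivative_on D X dX -> has_derivative_on D Y dY ->
  has_derivative_on D (fun t => col_mx (X t) (Y t)) (fun t => col_mx (dX t) (dY t)).
Proof.
move=> /has_derivative_on_mxP hX /has_derivative_on_mxP hY.
apply/has_derivative_on_mxP => i j.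
case: (split_ordP i) => k ->.
  by apply: eq_has_derivative_on (hX k j) => t _; rewrite col_mxEu.
by apply: eq_has_derivative_on (hY k j) => t _; rewrite col_mxEd.
Qed.

Lemma has_derivative_on_usubmx p q r (D : set R) (X dX : R -> 'M[R]_(p + q, r)) :
  has_derivative_on D X dX ->
  has_derivative_on D (fun t => usubmx (X t)) (fun t => usubmx (dX t)).
Proof.
move=> /has_derivative_on_mxP hX; apply/has_derivative_on_mxP => i j.
by apply: eq_has_derivative_on (hX (lshift q i) j) => t _; rewrite mxE.
Qed.

Lemma has_derivative_on_dsubmx p q r (D : set R) (X dX : R -> 'M[R]_(p + q, r)) :
  has_derivative_on D X dX ->
  has_derivative_on D (fun t => dsubmx (X t)) (fun t => dsubmx (dX t)).
Proof.
move=> /has_derivative_on_mxP hX; apply/has_derivative_on_mxP => i j.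
by apply: eq_has_derivative_on (hX (rshift p i) j) => t _; rewrite mxE.
Qed.

End MatrixCalculus.

(** * Algebra of the structure matrices *)

Section StructureMatrices.
Variables (R : realType) (m : nat).
Implicit Type bb : 'cV[R]_m.

Lemma firstvS : firstv R m.+1 = col_mx 1%:M 0 :> 'cV[R]_(1 + m).
Proof.
apply/colP => i; rewrite mxE; case: (split_ordP i) => k ->.
  by rewrite col_mxEu !mxE !ord1.
by rewrite col_mxEd mxE.
Qed.

Lemma shiftmxS : shiftmx R m.+1 =
  block_mx 0 (firstv R m)^T 0 (shiftmx R m) :> 'M[R]_(1 + m).
Proof.
apply/matrixP => i j; rewrite mxE.
case: (split_ordP i) => a ->; case: (split_ordP j) => b ->.
- by rewrite block_mxEul !mxE /= !ord1.
- by rewrite block_mxEur !mxE /= !ord1/= add1n eqSS.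
- by rewrite block_mxEdl !mxE /= !ord1.
- by rewrite block_mxEdr !mxE /= !add1n eqSS.
Qed.

Lemma LambdamxE bb : Lambdamx bb = shiftmx R m - bb *m (firstv R m)^T.
Proof.
apply/matrixP => i j; rewrite !mxE big_ord1 !mxE.
by case: ifP => [/eqP ->|_]; rewrite ?mulr1 ?mulr0 ?sub0r ?subr0.
Qed.

Lemma tr_firstvS : (firstv R m.+1)^T = row_mx 1%:M 0 :> 'M[R]_(1, 1 + m).
Proof. by rewrite firstvS (@tr_col_mx _ 1 m) trmx1 trmx0. Qed.

Lemma Gmx_bvec bb : Gmx bb *m bvec bb = 0.
Proof. by rewrite (@mul_row_col _ _ 1 m) mulmx1 mul1mx addNr. Qed.

Lemma firstv_bvec bb : (firstv R m.+1)^T *m bvec bb = 1%:M.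
Proof. by rewrite tr_firstvS (@mul_row_col _ _ 1 m) mul1mx mul0mx addr0. Qed.

(** G intertwines A_0 and Lambda on the kernel of C^T. *)
Lemma Gmx_shiftmx bb : Gmx bb *m shiftmx R m.+1 =
  Lambdamx bb *m Gmx bb + Lambdamx bb *m bb *m (firstv R m.+1)^T.
Proof.
rewrite shiftmxS tr_firstvS (@mul_row_block _ m 1 m 1 m) !(@mul_mx_row _ _ _ 1 m).
rewrite !mulmx0 addr0 !mulmx1 mul1mx (@add_row_mx _ _ 1 m) mulmxN addNr addr0.
by rewrite LambdamxE mulNmx addrC.
Qed.

(** The first component of A_0 e is the second component of e, which G e also
    exhibits when the first component of e vanishes. *)
Lemma firstv_shiftmx bb : (firstv R m.+1)^T *m shiftmx R m.+1 =
  (firstv R m)^T *m (Gmx bb + bb *m (firstv R m.+1)^T).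
Proof.
rewrite shiftmxS tr_firstvS (@mul_row_block _ 1 1 m 1 m) (@mul_mx_row _ _ _ 1 m).
rewrite mul1mx !mul0mx !addr0 mulmx1 mulmx0 (@add_row_mx _ _ 1 m) addNr addr0.
by rewrite (@mul_mx_row _ _ _ 1 m) mulmx0 mulmx1 mul1mx.
Qed.

End StructureMatrices.
(** * Equal outputs make parameters indistinguishable *)

Section Indistinguishability.
Variables (R : realType) (m r k d : nat).
Variables (bb : 'cV[R]_m) (phi : R * R -> 'cV[R]_r)
  (g : (R -> R) -> 'cV[R]_k * 'cV[R]_d -> R -> 'cV[R]_m.+1) (t0 T : R) (y : R -> R).
Hypothesis T_gt0 : 0 < T.
Implicit Type lam : 'cV[R]_k * 'cV[R]_d.

(** With e = xi - x and F the difference of the inputs, e' = A_0 e + F and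
    C^T e = 0. The witness p is u t0, where the function
    u = G e - (z lam' - z lam) satisfies u' = Lambda u, hence is
    exp(Lambda (t - t0)) u(t0), and the identity C^T (A_0 e + F) = 0 is
    eta = 0. *)
Lemma same_output_Eset (x xi : R -> 'cV[R]_m.+1) th th' lam lam' z :
  has_derivative_on `[t0, t0 + T] x (fun t =>
    shiftmx R m.+1 *m x t + bvec bb *m (phi (y t, t))^T *m th + g y lam t) ->
  has_derivative_on `[t0, t0 + T] xi (fun t =>
    shiftmx R m.+1 *m xi t + bvec bb *m (phi (y t, t))^T *m th' + g y lam' t) ->
  (forall t, t0 <= t <= t0 + T -> output xi t = output x t) ->
  is_zsol bb g t0 y lam (z lam) -> is_zsol bb g t0 y lam' (z lam') ->
  Eset bb phi g t0 y z th lam T (th', lam').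
Proof.
move=> hx hxi xi_x [z0 hz] [z'0 hz'].
pose e t := xi t - x t.
pose F t := bvec bb *m (phi (y t, t))^T *m (th' - th) + (g y lam' t - g y lam t).
have he : has_derivative_on `[t0, t0 + T] e (fun t => shiftmx R m.+1 *m e t + F t).
  apply: eq_has_derivative_on (has_derivative_onB hxi hx) => t _ //.
  rewrite /e /F mulmxBr [_ *m (th' - th)]mulmxBr.
  move: (shiftmx R m.+1 *m xi t) (shiftmx R m.+1 *m x t) => Sxi Sx.
  move: (_ *m th) (_ *m th') (g _ _ t) (g _ _ t) => Bth Bth' gl gl'.
  by apply/matrixP => i j; rewrite !mxE; ring.
have e1 t : t0 <= t <= t0 + T -> (firstv R m.+1)^T *m e t = 0.
  move=> tT; apply/matrixP => i j; rewrite !ord1 [RHS]mxE /e mulmxBr mxE [X in _ + X]mxE.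
  by move: (xi_x t tT); rewrite /output => ->; rewrite subrr.
have de1 t : t0 <= t <= t0 + T -> (firstv R m.+1)^T *m (shiftmx R m.+1 *m e t + F t) = 0.
  apply: (has_derivative_on_zero _ (has_derivative_on_mulmxl (M := (firstv R m.+1)^T) he) e1).
  by rewrite ltrDl.
pose u t := Gmx bb *m e t - (z lam' t - z lam t).
have sub : `[t0, t0 + T] `<=` `[t0, +oo[ by apply: subset_itvl; rewrite bnd_simp.
have GSe t : t0 <= t <= t0 + T ->
    Gmx bb *m (shiftmx R m.+1 *m e t) = Lambdamx bb *m (Gmx bb *m e t).
  move=> tT; rewrite !mulmxA Gmx_shiftmx mulmxDl -(mulmxA _ _ (e t)).
  by rewrite -(mulmxA _ _ (e t)) e1// mulmx0 addr0 mulmxA.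
have GF t : Gmx bb *m F t = Gmx bb *m g y lam' t - Gmx bb *m g y lam t.
  by rewrite /F mulmxDr !mulmxA Gmx_bvec !mul0mx add0r mulmxBr.
have hu : has_derivative_on `[t0, t0 + T] u (fun t => Lambdamx bb *m u t).
  have hzz := has_derivative_onB (sub_has_derivative_on sub hz') (sub_has_derivative_on sub hz).
  apply: eq_has_derivative_on (has_derivative_onB (has_derivative_on_mulmxl (M := Gmx bb) he) hzz) => t.
    by [].
  rewrite inE/= in_itv/= => tT.
  rewrite [Gmx bb *m _]mulmxDr GSe// GF /u (mulmxBr _ (Gmx bb *m e t)) (mulmxBr _ (z lam' t)).
  move: (_ *m (Gmx bb *m e t)) (Gmx bb *m g _ _ t) (Gmx bb *m g _ _ t) => Le Gl' Gl.
  move: (_ *m z _ t) (_ *m z _ t) => Lz' Lz.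
  by apply/matrixP => i j; rewrite !mxE; ring.
exists (u t0) => t tT.
have firstvS_e : (firstv R m.+1)^T *m (shiftmx R m.+1 *m e t) =
    (firstv R m)^T *m (Gmx bb *m e t).
  rewrite mulmxA (firstv_shiftmx bb) -mulmxA mulmxDl -(mulmxA _ _ (e t)) e1//.
  by rewrite mulmx0 addr0.
have firstv_F : (firstv R m.+1)^T *m F t = (phi (y t, t))^T *m (th' - th) +
    ((firstv R m.+1)^T *m g y lam' t - (firstv R m.+1)^T *m g y lam t).
  by rewrite /F mulmxDr !mulmxA firstv_bvec mul1mx -mulmxBr.
have ut : (firstv R m)^T *m expmx ((t - t0) *: Lambdamx bb) *m u t0 =
    (firstv R m)^T *m (Gmx bb *m e t) -
    ((firstv R m)^T *m z lam' t - (firstv R m)^T *m z lam t).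
  by rewrite -mulmxA -(linear_ode_expmx hu tT) /u (mulmxBr _ (Gmx bb *m e t)) (mulmxBr _ (z lam' t)).
have := de1 t tT; rewrite mulmxDr firstvS_e firstv_F /Defs.eta/= ut.
move: (_ *m (Gmx bb *m e t)) (_ *m (th' - th)) => A B.
move: (_ *m g _ lam' t) (_ *m g _ lam t) => C C'.
move: (_ *m z lam' t) (_ *m z lam t) => Z' Z.
move=> /(congr1 (fun M : 'M[R]_1 => M 0 0)); rewrite !mxE => h.
by rewrite -[RHS]h; ring.
Qed.

End Indistinguishability.
(** * Observability *)

Section Observability.
Variables (R : realType) (m : nat).

(** If the i-th component vanishes identically then so does its derivative, which
    is the next component. *)
Lemma zero_output_eq0 (e : R -> 'cV[R]_m.+1) (a b : R) : a < b ->
  has_derivative_on `[a, b] e (fun t => shiftmx R m.+1 *m e t) ->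
  (forall t, a <= t <= b -> output e t = 0) ->
  forall t, a <= t <= b -> e t = 0.
Proof.
move=> ab /has_derivative_on_mxP he e0.
have ei0 i (im : (i < m.+1)%N) t : a <= t <= b -> e t (Ordinal im) 0 = 0.
  elim: i im t => [|i IH] im t tab.
    have := e0 t tab; rewrite /output mxE (bigD1 (Ordinal im))//= big1 ?addr0.
      by rewrite !mxE/= mul1r.
    by move=> j j0; rewrite !mxE (negbTE (_ : val j != 0%N)) ?mul0r.
  have im' : (i < m.+1)%N := ltnW im.
  have hX : has_derivative_on `[a, b] (fun t => (e t (Ordinal im') 0)%:M : 'M[R]_1)
      (fun t => ((shiftmx R m.+1 *m e t) (Ordinal im') 0)%:M).
    apply/has_derivative_on_mxP => j k.
    apply: eq_has_derivative_on (he (Ordinal im') 0) => s _;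
    by rewrite !ord1 [RHS]mxE mulr1n.
  have := has_derivative_on_zero ab hX _ tab.
  move=> /(_ _)/matrixP/(_ 0 0); rewrite !mxE mulr1n (bigD1 (Ordinal im))//= big1 ?addr0.
    rewrite mxE/= eqxx mul1r; apply => s sab.
    by rewrite IH//; apply/matrixP => j k; rewrite !mxE mul0rn.
  by move=> j ji; rewrite mxE (negbTE (_ : val j != i.+1)) ?mul0r.
move=> t tab; apply/colP => -[i im]; rewrite [RHS]mxE; exact: ei0.
Qed.

End Observability.

(** * The observer equation *)

Section Observer.
Variables (R : realType) (m r : nat).
Variables (bb : 'cV[R]_m) (l : 'cV[R]_m.+1) (psi : R -> 'cV[R]_r) (t0 : R).
Hypothesis psi_cont : {within `[t0, +oo[, continuous psi}.

Definition obsmx (t : R) : 'M[R]_(m.+1 + r) :=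
  block_mx (closedloop l) (bvec bb *m (psi t)^T)
           (- (psi t *m (firstv R m.+1)^T)) 0.

Lemma obsmx_bounded b : exists K, forall t, t0 <= t <= b -> forall i j, `|obsmx t i j| <= K.
Proof.
apply: mx_within_continuous_bounded; apply/subspace_continuousP => t tab.
have psit i : psi s i 0 @[s --> within `[t0, b] (nbhs t)] --> psi t i 0.
  have /cvg_mxP : psi @ within `[t0, b] (nbhs t) --> psi t.
    have h : {within `[t0, b], continuous psi}.
      by apply: continuous_subspaceW psi_cont; exact: subset_itvl.
    by move/subspace_continuousP: h; exact.
  exact.
suff : obsmx @ within `[t0, b] (nbhs t) --> obsmx t by exact.
apply/cvg_mxP => i j; case: (split_ordP i) => i' ->; case: (split_ordP j) => j' ->.
- have E s : obsmx s (lshift r i') (lshift r j') = closedloop l i' j'.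
    by rewrite block_mxEul.
  by rewrite E; apply: cvg_ext (@cvg_cst _ (closedloop l i' j') _ _ _) => s; rewrite E.
- have E s : obsmx s (lshift r i') (rshift m.+1 j') = bvec bb i' 0 * psi s j' 0.
    by rewrite block_mxEur mxE big_ord1 [(psi s)^T _ _]mxE.
  rewrite E; apply: cvg_ext (cvgM (@cvg_cst _ (bvec bb i' 0) _ _ _) (psit j')) => s.
  by rewrite E.
- have E s : obsmx s (rshift m.+1 i') (lshift r j') = - (psi s i' 0 * firstv R m.+1 j' 0).
    by rewrite block_mxEdl mxE mxE big_ord1 [(firstv _ _)^T _ _]mxE.
  rewrite E; apply: cvg_ext (cvgN (cvgM (psit i') (@cvg_cst _ (firstv R m.+1 j' 0) _ _ _))) => s.
  by rewrite E.
- have E s : obsmx s (rshift m.+1 i') (rshift m.+1 j') = 0 by rewrite block_mxEdr mxE.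
  by rewrite E; apply: cvg_ext (@cvg_cst _ (0 : R) _ _ _) => s; rewrite E.
Qed.

Variable Phi : R -> 'M[R]_(m.+1 + r).
Hypotheses (Phi0 : Phi t0 = 1%:M)
  (Phi_deriv : has_derivative_on `[t0, +oo[ Phi (fun t => obsmx t *m Phi t)).

Let sub (b : R) : `[t0, b] `<=` `[t0, +oo[.
Proof. exact: subset_itvl. Qed.

(** If Phi t c = 0 then the solution Phi s c, which vanishes at s = t, vanishes
    at t0 by backward uniqueness, where it equals c. *)
Lemma fundamental_unit t : t0 <= t -> Phi t \in unitmx.
Proof.
move=> t0t; apply: unitmx_ker0 => c Phic.
have [K MK] := obsmx_bounded t.
have h := has_derivative_on_mulmxr (M := c) (sub_has_derivative_on (@sub t) Phi_deriv).
have h' : has_derivative_on `[t0, t] (fun s => Phi s *m c) (fun s => obsmx s *m (Phi s *m c)).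
  by apply: eq_has_derivative_on h => s _ //; rewrite mulmxA.
have := linear_ode_eq0 h' MK (s := t); rewrite t0t lexx => /(_ isT Phic t0).
by rewrite t0t lexx Phi0 mul1mx => /(_ isT).
Qed.

Variable f : R -> 'cV[R]_(m.+1 + r).
Hypothesis f_cont : {within `[t0, +oo[, continuous f}.

Lemma invPhi_f_continuous : {within `[t0, +oo[, continuous (fun s => invmx (Phi s) *m f s)}.
Proof.
apply/subspace_continuousP => t Dt; apply/cvg_mxP => i j; rewrite mxE.
have t0t : t0 <= t by move: Dt; rewrite /= in_itv/= andbT.
have invc : invmx (Phi s) @[s --> within `[t0, +oo[ (nbhs t)] --> invmx (Phi t).
  apply: cvg_invmx.
  - exact: fundamental_unit.
  - rewrite near_withinE; near=> s; rewrite /= in_itv/= andbT; exact: fundamental_unit.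
  - exact: has_derivative_on_cvg Phi_deriv Dt.
have h : \sum_k invmx (Phi s) i k * f s k j @[s --> within `[t0, +oo[ (nbhs t)] -->
    \sum_k invmx (Phi t) i k * f t k j.
  apply: cvg_sumR => k; apply: cvgM.
    by move/cvg_mxP: invc; exact.
  by have /subspace_continuousP/(_ t Dt)/cvg_mxP := f_cont; exact.
by apply: cvg_ext h => s; rewrite mxE.
Unshelve. all: by end_near. Qed.

Lemma variation_of_constants c :
  has_derivative_on `[t0, +oo[
    (fun t => Phi t *m (c + mxintegral t0 t (fun s => invmx (Phi s) *m f s)))
    (fun t => obsmx t *m (Phi t *m (c + mxintegral t0 t (fun s => invmx (Phi s) *m f s))) + f t).
Proof.
have hI := has_derivative_on_mxintegral invPhi_f_continuous.
have h := has_derivative_on_mulmx Phi_deriv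
  (has_derivative_onD (@has_derivative_on_cst _ _ `[t0, +oo[ c) hI).
apply: eq_has_derivative_on h => t //.
rewrite inE/= in_itv/= andbT => t0t; rewrite add0r mulmxA; congr (_ + _).
by rewrite mulmxA mulmxV ?mul1mx// fundamental_unit.
Qed.

Lemma variation_of_constants_unique (X : R -> 'cV[R]_(m.+1 + r)) :
  has_derivative_on `[t0, +oo[ X (fun t => obsmx t *m X t + f t) ->
  forall t, t0 <= t ->
    X t = Phi t *m (X t0 + mxintegral t0 t (fun s => invmx (Phi s) *m f s)).
Proof.
move=> hX t t0t; apply/eqP; rewrite -subr_eq0; apply/eqP.
have [K MK] := obsmx_bounded t.
have h := has_derivative_onB hX (@variation_of_constants (X t0)).
have h' := sub_has_derivative_on (@sub t) h.
have h'' : has_derivative_on `[t0, t]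
    (fun s => X s - Phi s *m (X t0 + mxintegral t0 s (fun s => invmx (Phi s) *m f s)))
    (fun s => obsmx s *m (X s - Phi s *m (X t0 + mxintegral t0 s (fun s => invmx (Phi s) *m f s)))).
  apply: eq_has_derivative_on h' => s _ //.
  by rewrite opprD addrACA subrr addr0 -mulmxBr.
apply: (linear_ode_eq0 h'' MK (s := t0)); rewrite ?lexx ?t0t//.
by rewrite Phi0 mul1mx mxintegral_same addr0 subrr.
Qed.

End Observer.
(** * Stability of the observer *)

(** The two cross terms coming from the coupling b p^T cancel because P b = C. *)
Lemma lyapunov_identity (R : realType) n r (A P Q : 'M[R]_n) (b C u : 'cV[R]_n)
    (p w : 'cV[R]_r) :
  P^T = P -> P *m A + A^T *m P = - Q -> P *m b = C ->
  (A *m u + b *m p^T *m w)^T *m P *m u + u^T *m P *m (A *m u + b *m p^T *m w) +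
    ((- (p *m C^T *m u))^T *m w + w^T *m (- (p *m C^T *m u))) = - (u^T *m Q *m u).
Proof.
move=> P_sym PQ Pb; have bP : b^T *m P = C^T by rewrite -{1}P_sym -trmx_mul Pb.
pose s := p^T *m w; pose c := C^T *m u.
have -> : A *m u + b *m p^T *m w = A *m u + b *m s by rewrite mulmxA.
have -> : p *m C^T *m u = p *m c by rewrite mulmxA.
have -> : (A *m u + b *m s)^T *m P *m u = u^T *m (A^T *m P) *m u + s^T *m c.
  by rewrite [in LHS]linearD/= !mulmxDl !trmx_mul /c -bP !mulmxA.
have -> : u^T *m P *m (A *m u + b *m s) = u^T *m (P *m A) *m u + c^T *m s.
  by rewrite [LHS]mulmxDr /c trmx_mul trmxK -Pb !mulmxA.
have -> : (- (p *m c))^T *m w = - (c^T *m s).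
  by rewrite linearN/= mulNmx trmx_mul -mulmxA.
have -> : w^T *m (- (p *m c)) = - (s^T *m c).
  by rewrite mulmxN /s trmx_mul trmxK mulmxA.
have <- : u^T *m (P *m A) *m u + u^T *m (A^T *m P) *m u = - (u^T *m Q *m u).
  by rewrite -mulmxDl -mulmxDr PQ mulmxN mulNmx.
move: (u^T *m (P *m A) *m u) (u^T *m (A^T *m P) *m u) (s^T *m c) (c^T *m s) => a a' e e'.
by apply/matrixP => i j; rewrite !mxE; ring.
Qed.

Section ObserverStability.
Variables (R : realType) (m r : nat).
Variables (bb : 'cV[R]_m) (l : 'cV[R]_m.+1) (psi : R -> 'cV[R]_r) (t0 T : R).
Hypotheses (psi_cont : {within `[t0, +oo[, continuous psi}) (T_gt0 : 0 < T).
Hypothesis l_gain : observer_gain bb l.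
Hypothesis psi_PE : exists2 delta : R, 0 < delta &
  possemidef (mxintegral t0 (t0 + T) (fun s => psi s *m (psi s)^T) - delta%:M).

Local Notation C := (firstv R m.+1).
Local Notation b := (bvec bb).

(** V is constant along the solution because it is nonincreasing and takes the
    same value at both ends of the period; so its derivative, minus a positive
    definite form in the upper block x1, is zero. *)
Lemma periodic_homogeneous_eq0 (xi : R -> 'cV[R]_(m.+1 + r)) :
  has_derivative_on `[t0, t0 + T] xi (fun t => obsmx bb l psi t *m xi t) ->
  xi (t0 + T) = xi t0 -> xi t0 = 0.
Proof.
have [P [Q [[P_sym P_pos] [_ Q_pos] PQ Pb]]] := l_gain.
move=> hxi per; pose x1 t := usubmx (xi t); pose x2 t := dsubmx (xi t).
have tT : t0 < t0 + T by rewrite ltrDl.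
have h1 : has_derivative_on `[t0, t0 + T] x1
    (fun t => closedloop l *m x1 t + b *m (psi t)^T *m x2 t).
  apply: eq_has_derivative_on (has_derivative_on_usubmx hxi) => t _ //.
  by rewrite -{1}[xi t]vsubmxK mul_block_col col_mxKu.
have h2 : has_derivative_on `[t0, t0 + T] x2 (fun t => - (psi t *m C^T *m x1 t)).
  apply: eq_has_derivative_on (has_derivative_on_dsubmx hxi) => t _ //.
  by rewrite -{1}[xi t]vsubmxK mul_block_col col_mxKd mul0mx addr0 mulNmx.
pose V t := (x1 t)^T *m P *m x1 t + (x2 t)^T *m x2 t.
have hV : has_derivative_on `[t0, t0 + T] V (fun t => - ((x1 t)^T *m Q *m x1 t)).
  have hPx1 := has_derivative_on_mulmxr (M := P) (has_derivative_on_trmx h1).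
  have h := has_derivative_onD (has_derivative_on_mulmx hPx1 h1)
    (has_derivative_on_mulmx (has_derivative_on_trmx h2) h2).
  apply: eq_has_derivative_on h => t _ //.
  exact: lyapunov_identity.
have Q0 t : t0 <= t <= t0 + T -> ((x1 t)^T *m Q *m x1 t) = 0.
  pose v t : R := V t 0 0.
  have hv : has_derivative_on `[t0, t0 + T] (fun t => - v t : R^o)
      (fun t => ((x1 t)^T *m Q *m x1 t) 0 0).
    move/has_derivative_on_mxP/(_ 0 0)/has_derivative_onN: hV.
    by apply: eq_has_derivative_on => s _ //; rewrite mxE opprK.
  have q0 s : 0 <= ((x1 s)^T *m Q *m x1 s) 0 0.
    by have [->|x10] := eqVneq (x1 s) 0; [rewrite mulmx0 mxE|exact/ltW/Q_pos].
  have mono s u : t0 <= s -> s <= u -> u <= t0 + T -> v u <= v s.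
    move=> t0s su uT; rewrite -lerN2.
    have sub : `[s, u] `<=` `[t0, t0 + T] by apply: subset_itv; rewrite bnd_simp.
    exact: ge0_has_derivative_on_le su (sub_has_derivative_on sub hv) _.
  have vT : v (t0 + T) = v t0 by rewrite /v /V /x1 /x2 per.
  have vcst s : t0 <= s <= t0 + T -> V s - V t0 = 0.
    move=> /andP[t0s sT]; apply/matrixP => i j; rewrite !ord1 mxE [X in _ + X]mxE [RHS]mxE.
    rewrite -/(v s) -/(v t0); apply/eqP; rewrite subr_eq0 eq_le mono//=.
    by rewrite -vT mono.
  have hV0 := has_derivative_onB hV (@has_derivative_on_cst _ _ `[t0, t0 + T] (V t0)).
  move=> tab; have := has_derivative_on_zero tT hV0 vcst tab.
  by rewrite subr0 => /eqP; rewrite oppr_eq0 => /eqP.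
have x10 t : t0 <= t <= t0 + T -> x1 t = 0.
  move=> tab; apply/eqP; apply: contraT => /Q_pos.
  by rewrite Q0// mxE ltxx.
have psix2 t : t0 <= t <= t0 + T -> (psi t)^T *m x2 t = 0.
  move=> tab; have := has_derivative_on_zero tT h1 x10 tab.
  rewrite x10// mulmx0 add0r => /(congr1 (mulmx C^T)).
  by rewrite mulmx0 !mulmxA firstv_bvec mul1mx.
have x2c t : t0 <= t <= t0 + T -> x2 t = x2 t0.
  apply: (has_derivative_on0_eq h2) => s sab.
  by rewrite x10// mulmx0 oppr0.
have x20 : x2 t0 = 0.
  (* x2^T F x2 has derivative x2^T psi psi^T x2 = 0 and F t0 = 0. *)
  pose F t := mxintegral t0 t (fun s => psi s *m (psi s)^T).
  have pp_cont : {within `[t0, +oo[, continuous (fun s => psi s *m (psi s)^T)}.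
    apply/subspace_continuousP => t Dt; apply/cvg_mxP => i j.
    have /subspace_continuousP/(_ t Dt)/cvg_mxP psit := psi_cont.
    rewrite mxE big_ord1 mxE; apply: cvg_ext (cvgM (psit i 0) (psit j 0)) => s.
    by rewrite mxE big_ord1 mxE.
  have hF : has_derivative_on `[t0, t0 + T] F (fun s => psi s *m (psi s)^T).
    apply: sub_has_derivative_on (has_derivative_on_mxintegral pp_cont).
    exact: subset_itvl.
  have hq := has_derivative_on_mulmxr (M := x2 t0)
    (has_derivative_on_mulmxl (M := (x2 t0)^T) hF).
  have q0 : (x2 t0)^T *m F (t0 + T) *m x2 t0 = 0.
    rewrite (has_derivative_on0_eq hq) ?lexx ?(ltW tT)// => [|s sab].
      by rewrite /F mxintegral_same mulmx0 mul0mx.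
    by rewrite -!mulmxA -{2}(x2c s)// psix2// !mulmx0.
  have [delta delta0 [_ /(_ (x2 t0))]] := psi_PE.
  rewrite -/(F (t0 + T)) mulmxBr mulmxBl q0 sub0r mul_mx_scalar -scalemxAl mxE oppr_ge0.
  rewrite mxE pmulr_rle0// mxE => h.
  have : \sum_k (x2 t0)^T 0 k * x2 t0 k 0 == 0.
    rewrite eq_le h/=; apply: sumr_ge0 => k _; rewrite mxE -expr2; exact: sqr_ge0.
  rewrite psumr_eq0 => [/allP x2k|k _]; last by rewrite mxE -expr2 sqr_ge0.
  apply/colP => k; have := x2k k; rewrite mem_index_enum => /(_ isT).
  by rewrite mxE -expr2 sqrf_eq0 [RHS]mxE => /eqP.
rewrite -[xi t0]vsubmxK -/(x1 t0) -/(x2 t0) x20 x10 ?lexx ?(ltW tT)//.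
by rewrite col_mx0.
Qed.

Variable Phi : R -> 'M[R]_(m.+1 + r).
Hypotheses (Phi0 : Phi t0 = 1%:M)
  (Phi_deriv : has_derivative_on `[t0, +oo[ Phi (fun t => obsmx bb l psi t *m Phi t)).

Lemma monodromy_unit : 1%:M - Phi (t0 + T) \in unitmx.
Proof.
apply: unitmx_ker0 => c; rewrite mulmxBl mul1mx => /eqP; rewrite subr_eq0 => /eqP cT.
have h := has_derivative_on_mulmxr (M := c) Phi_deriv.
have sub : `[t0, t0 + T] `<=` `[t0, +oo[ by exact: subset_itvl.
have h' : has_derivative_on `[t0, t0 + T] (fun s => Phi s *m c)
    (fun s => obsmx bb l psi s *m (Phi s *m c)).
  by apply: eq_has_derivative_on (sub_has_derivative_on sub h) => s _ //; rewrite mulmxA.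
have := periodic_homogeneous_eq0 h'; rewrite Phi0 mul1mx; apply.
by rewrite -cT.
Qed.

End ObserverStability.
(** * Observer equation and state equation *)

Section ObserverState.
Variables (R : realType) (m r k d : nat).
Variables (bb : 'cV[R]_m) (phi : R * R -> 'cV[R]_r)
  (g : (R -> R) -> 'cV[R]_k * 'cV[R]_d -> R -> 'cV[R]_m.+1) (t0 : R) (y : R -> R).
Variable l : 'cV[R]_m.+1.
Implicit Type lam : 'cV[R]_k * 'cV[R]_d.

Local Notation psi := (fun t => phi (y t, t)).

Lemma firstv_usubmx (xi : 'cV[R]_(m.+1 + r)) :
  (firstv R (m.+1 + r))^T *m xi = (firstv R m.+1)^T *m usubmx xi.
Proof.
have -> : firstv R (m.+1 + r) = col_mx (firstv R m.+1) 0.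
  apply/colP => i; rewrite mxE; case: (split_ordP i) => j ->.
    by rewrite col_mxEu mxE.
  by rewrite col_mxEd mxE.
by rewrite -{1}[xi]vsubmxK tr_col_mx trmx0 mul_row_col mul0mx addr0.
Qed.

Lemma closedloop_mul (xt : 'cV[R]_m.+1) :
  closedloop l *m xt = shiftmx R m.+1 *m xt + ((firstv R m.+1)^T *m xt) 0 0 *: l.
Proof.
by rewrite mulmxDl -mulmxA [_^T *m xt]mx11_scalar mul_mx_scalar [in RHS]mxE eqxx mulr1n.
Qed.

Lemma firstv_mul_psi t (xt : 'cV[R]_m.+1) :
  psi t *m (firstv R m.+1)^T *m xt = ((firstv R m.+1)^T *m xt) 0 0 *: psi t.
Proof.
by rewrite -mulmxA [_^T *m xt]mx11_scalar mul_mx_scalar [in RHS]mxE eqxx mulr1n.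
Qed.

(** Output injection: the terms l C^T x and y l cancel when y is the output, and
    the lower block becomes - psi C^T x + y psi = 0. *)
Lemma obsmx_state t (xt : 'cV[R]_m.+1) th lam : y t = ((firstv R m.+1)^T *m xt) 0 0 ->
  obsmx bb l psi t *m col_mx xt th + forcing phi g y l lam t =
  col_mx (shiftmx R m.+1 *m xt + bvec bb *m (psi t)^T *m th + g y lam t) 0.
Proof.
move=> yt; rewrite mul_block_col mul0mx addr0 add_col_mx; congr col_mx.
  rewrite closedloop_mul -yt.
  move: (shiftmx _ _ *m xt) (_ *m th) (g y lam t) (y t *: l) => a b c e.
  by apply/matrixP => i j; rewrite !mxE; ring.
by rewrite mulNmx firstv_mul_psi -yt addNr.
Qed.

Lemma state_observer (D : set R) (x : R -> 'cV[R]_m.+1) th lam :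
  has_derivative_on D x (fun t =>
    shiftmx R m.+1 *m x t + bvec bb *m (psi t)^T *m th + g y lam t) ->
  (forall t, D t -> output x t = y t) ->
  has_derivative_on D (fun t => col_mx (x t) th)
    (fun t => obsmx bb l psi t *m col_mx (x t) th + forcing phi g y l lam t).
Proof.
move=> hx xy; have h := has_derivative_on_col_mx hx (@has_derivative_on_cst _ _ D th).
apply: eq_has_derivative_on h => t // /set_mem Dt.
by rewrite obsmx_state// -xy.
Qed.

Lemma observer_state (a b : R) (xi : R -> 'cV[R]_(m.+1 + r)) lam :
  has_derivative_on `[a, b] xi
    (fun t => obsmx bb l psi t *m xi t + forcing phi g y l lam t) ->
  (forall t, a <= t <= b -> ((firstv R (m.+1 + r))^T *m xi t) 0 0 = y t) ->
  has_derivative_on `[a, b] (fun t => usubmx (xi t)) (fun t =>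
    shiftmx R m.+1 *m usubmx (xi t) + bvec bb *m (psi t)^T *m dsubmx (xi a) + g y lam t).
Proof.
move=> hxi xiy.
have E t : a <= t <= b -> obsmx bb l psi t *m xi t + forcing phi g y l lam t =
    col_mx (shiftmx R m.+1 *m usubmx (xi t) + bvec bb *m (psi t)^T *m dsubmx (xi t)
      + g y lam t) 0.
  move=> tab; rewrite -{1}[xi t]vsubmxK obsmx_state//.
  by rewrite -firstv_usubmx xiy.
(* The lower block of the right-hand side is zero. *)
have d0 t : a <= t <= b -> dsubmx (xi t) = dsubmx (xi a).
  apply: (has_derivative_on0_eq (has_derivative_on_dsubmx hxi)) => s sab.
  by rewrite E// col_mxKd.
apply: eq_has_derivative_on (has_derivative_on_usubmx hxi) => t //.
by rewrite inE/= in_itv/= => tab; rewrite E// col_mxKu d0.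
Qed.

Lemma forcing_continuous lam : {within `[t0, +oo[, continuous y} ->
  {within `[t0, +oo[, continuous psi} -> {within `[t0, +oo[, continuous (g y lam)} ->
  {within `[t0, +oo[, continuous (forcing phi g y l lam)}.
Proof.
move=> /subspace_continuousP yc /subspace_continuousP psic /subspace_continuousP gc.
apply/subspace_continuousP => t Dt.
suff : forcing phi g y l lam @ within `[t0, +oo[ (nbhs t) --> forcing phi g y l lam t by exact.
have yt : y @ within `[t0, +oo[ (nbhs t) --> y t := yc t Dt.
have /cvg_mxP psit : psi @ within `[t0, +oo[ (nbhs t) --> psi t := psic t Dt.
have /cvg_mxP gt : g y lam @ within `[t0, +oo[ (nbhs t) --> g y lam t := gc t Dt.
apply/cvg_mxP => i j; case: (split_ordP i) => i' ->.
- have E s : forcing phi g y l lam s (lshift r i') j = g y lam s i' j - y s * l i' j.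
    by rewrite col_mxEu [LHS]mxE; congr (_ + _); rewrite [LHS]mxE [in LHS]mxE.
  rewrite E; apply: cvg_ext (cvgB (gt i' j) (cvgM yt (@cvg_cst _ (l i' j) _ _ _))) => s.
  by rewrite E.
- have E s : forcing phi g y l lam s (rshift m.+1 i') j = y s * psi s i' j.
    by rewrite col_mxEd [LHS]mxE.
  by rewrite E; apply: cvg_ext (cvgM yt (psit i' j)) => s; rewrite E.
Qed.

(** The shifted difference x(t + T) - x(t) solves e' = A_0 e with zero output. *)
Lemma state_periodic (x : R -> 'cV[R]_m.+1) th lam (T : R) : 0 <= T ->
  has_derivative_on `[t0, +oo[ x (fun t =>
    shiftmx R m.+1 *m x t + bvec bb *m (psi t)^T *m th + g y lam t) ->
  y = output x -> periodic_from t0 T y -> periodic_from t0 T psi ->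
  periodic_from t0 T (g y lam) -> x (t0 + T) = x t0.
Proof.
move=> T0 hx yx y_per psi_per g_per; apply/eqP; rewrite -subr_eq0; apply/eqP.
pose e t := x (t + T) - x t.
have he : has_derivative_on `[t0, t0 + 1] e (fun t => shiftmx R m.+1 *m e t).
  have h := has_derivative_onB (has_derivative_on_shift T0 hx) hx.
  have h' := sub_has_derivative_on (@subset_itvl _ _ (BLeft t0) (BRight (t0 + 1)) +oo%O isT) h.
  apply: eq_has_derivative_on h' => t //; rewrite inE/= in_itv/= => /andP[t0t _].
  rewrite psi_per// g_per// (mulmxBr _ (x (t + T)) (x t)).
  move: (_ *m x _) (_ *m x t) (_ *m th) (g _ _ t) => a b c e'.
  by apply/matrixP => i j; rewrite !mxE; ring.
apply: (zero_output_eq0 _ he); rewrite ?ltrDl ?lexx ?lerDl ?ler01//.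
move=> t /andP[t0t _]; have := y_per t t0t; rewrite yx /output /e mulmxBr.
by move: (_ *m x (t + T)) (_ *m x t) => A B AB; rewrite !mxE AB subrr.
Qed.

End ObserverState.

Theorem mainTheorem1 (R : realType) (m r k d : nat)
  (bb : 'cV[R]_m) (hurwitz_b : hurwitz (bpoly bb))
  (phi : R * R -> 'cV[R]_r)
  (phi_cont : continuous phi)
  (phi_diff : forall u, differentiable phi u)
  (v : R * 'cV[R]_d * 'cV[R]_k * R -> 'cV[R]_m.+1)
  (v_cont : continuous v) (v_diff : forall u, differentiable v u)
  (P : R * 'cV[R]_k * R -> 'M[R]_d)
  (P_cont : continuous P) (P_diff : forall u, differentiable P u)
  (P_diag : forall u, is_diag_mx (P u))
  (w : R * 'cV[R]_k * R -> 'cV[R]_d)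
  (w_cont : continuous w) (w_diff : forall u, differentiable w u)
  (t0 T : R) (T_gt0 : 0 < T)
  (x0 : 'cV[R]_m.+1) (th : 'cV[R]_r) (lam : 'cV[R]_k * 'cV[R]_d)
  (x : R -> 'cV[R]_m.+1)
  (x_sol : is_solution bb phi (gfun v P w t0) t0 `[t0, +oo[ x0 th lam x)
  (y : R -> R) (y_output : y = output x)
  (z : 'cV[R]_k * 'cV[R]_d -> R -> 'cV[R]_m)
  (z_sol : forall mu, is_zsol bb (gfun v P w t0) t0 y mu (z mu))
  (E0E : E0set bb phi (gfun v P w t0) t0 y th lam T
         = Eset bb phi (gfun v P w t0) t0 y z th lam T)
  (E_sub1 : is_subset1 (Eset bb phi (gfun v P w t0) t0 y z th lam T))
  (y_per : periodic_from t0 T y)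
  (phi_per : periodic_from t0 T (fun t => phi (y t, t)))
  (g_per : forall mu, periodic_from t0 T (gfun v P w t0 y mu))
  (phi_PE : exists2 delta : R, 0 < delta &
     possemidef (mxintegral t0 (t0 + T)
                   (fun s => phi (y s, s) *m (phi (y s, s))^T)
                 - delta%:M))
  (l : 'cV[R]_m.+1) (l_gain : observer_gain bb l)
  (Phi : R -> 'M[R]_(m.+1 + r))
  (Phi_fund : is_fundamental bb phi t0 y l Phi)
  (lam' : 'cV[R]_k * 'cV[R]_d) :
  let st1 := forall t, t0 <= t <= t0 + T ->
    yhat phi (gfun v P w t0) t0 y l Phi T lam' t = y t in
  let st2 := exists x' : R -> 'cV[R]_m.+1,
    is_solution bb phi (gfun v P w t0) t0 `[t0, t0 + T] x0 th lam' x' /\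
    forall t, t0 <= t <= t0 + T -> output x' t = y t in
  (st1 <-> st2) /\
  (st1 /\ st2 -> col_mx x0 th = Rvec phi (gfun v P w t0) t0 y l Phi T lam').
Proof.
have [x_t0 hx] := x_sol; rewrite -y_output in hx.
set g := gfun v P w t0 in hx g_per E0E E_sub1 z_sol x_sol *.
pose psi t := phi (y t, t).
have xy t : output x t = y t by rewrite y_output.
have y_cont : {within `[t0, +oo[, continuous y}.
  apply/subspace_continuousP => t Dt.
  have /cvg_mxP/(_ 0 0) := has_derivative_on_cvg
    (has_derivative_on_mulmxl (M := (firstv R m.+1)^T) hx) Dt.
  by rewrite y_output.
have psi_cont : {within `[t0, +oo[, continuous psi}.
  apply/subspace_continuousP => t Dt.
  suff : phi (y s, s) @[s --> within `[t0, +oo[ (nbhs t)] --> phi (y t, t) by exact.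
  have arg : (y s, s) @[s --> within `[t0, +oo[ (nbhs t)] --> (y t, t).
    apply: cvg_pairT; last exact: cvg_within.
    by move/subspace_continuousP: y_cont; exact.
  by apply: continuous_cvg arg; exact: phi_cont.
have g_cont mu : {within `[t0, +oo[, continuous (g y mu)} by exact: gfun_continuous.
have f_cont mu := forcing_continuous (l := l) y_cont psi_cont (g_cont mu).
have [Phi0 hPhi] := Phi_fund.
have sub : `[t0, t0 + T] `<=` `[t0, +oo[ by exact: subset_itvl.
have hxT := sub_has_derivative_on sub hx.
(* The pair (th', mu) and the true pair both lie in the set E, which has at most
   one element. *)
have identify (xi : R -> 'cV[R]_m.+1) th' mu :
    has_derivative_on `[t0, t0 + T] xi (fun t =>
      shiftmx R m.+1 *m xi t + bvec bb *m (phi (y t, t))^T *m th' + g y mu t) ->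
    (forall t, t0 <= t <= t0 + T -> output xi t = y t) -> mu = lam.
  move=> hxi xiy.
  have Exi : Eset bb phi g t0 y z th lam T (th', mu).
    by apply: (same_output_Eset T_gt0 hxT hxi) => // t tT; rewrite xiy.
  have Ex : Eset bb phi g t0 y z th lam T (th, lam).
    exact: (same_output_Eset T_gt0 hxT hxT).
  by have := E_sub1 _ _ Exi Ex => -[].
have true_obs : lam' = lam ->
    col_mx x0 th = Rvec phi g t0 y l Phi T lam' /\
    forall t, t0 <= t <= t0 + T -> yhat phi g t0 y l Phi T lam' t = y t.
  move=> ->.
  pose I t := mxintegral t0 t (fun s => invmx (Phi s) *m forcing phi g y l lam s).
  have XE t : t0 <= t -> col_mx (x t) th = Phi t *m (col_mx x0 th + I t).
    have hX := state_observer (l := l) hx (fun s _ => xy s).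
    rewrite -x_t0 => t0t.
    exact: (variation_of_constants_unique psi_cont Phi0 hPhi (f_cont lam) hX t0t).
  have xT : x (t0 + T) = x0.
    by rewrite -x_t0; apply: (state_periodic (ltW T_gt0) hx).
  have MT : 1%:M - Phi (t0 + T) \in unitmx.
    exact: (monodromy_unit psi_cont T_gt0 l_gain phi_PE Phi0 hPhi).
  have RE : col_mx x0 th = Rvec phi g t0 y l Phi T lam.
    have := XE (t0 + T); rewrite xT lerDl => /(_ (ltW T_gt0)).
    rewrite mulmxDr => /eqP; rewrite addrC -subr_eq -{1}[col_mx x0 th]mul1mx -mulmxBl.
    move=> /eqP /(congr1 (mulmx (invmx (1%:M - Phi (t0 + T))))).
    by rewrite mulKmx// mulmxA.
  split=> // t /andP[t0t _].
  by rewrite /yhat -RE -mulmxDr -XE// firstv_usubmx col_mxKu -xy.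
have st2_lam (x' : R -> 'cV[R]_m.+1) :
    is_solution bb phi g t0 `[t0, t0 + T] x0 th lam' x' ->
    (forall t, t0 <= t <= t0 + T -> output x' t = y t) -> lam' = lam.
  move=> [_ hx'] x'y.
  (* The equation for x' is driven by its own output, which is y on the interval. *)
  have gE t : t0 <= t <= t0 + T -> g (output x') lam' t = g y lam' t.
    move=> /andP[t0t tT]; apply: (eq_gfun _ _ _ _ t0t) => s /andP[t0s st].
    by apply: x'y; rewrite t0s (le_trans st).
  apply: (identify x' th lam' _ x'y).
  apply: (eq_has_derivative_on _ _ hx') => t; first by [].
  by rewrite inE/= in_itv/= => tT; rewrite (x'y t tT) (gE t tT).
split; last first.
  by case=> [_ [x' [hx' x'y]]]; apply: (true_obs _).1; exact: st2_lam hx' x'y.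
split=> [st1|[x' [hx' x'y]]]; last by apply: (true_obs _).2; exact: st2_lam hx' x'y.
pose xi t := Phi t *m (Rvec phi g t0 y l Phi T lam' +
  mxintegral t0 t (fun s => invmx (Phi s) *m forcing phi g y l lam' s)).
have hxi : has_derivative_on `[t0, t0 + T] xi
    (fun t => obsmx bb l psi t *m xi t + forcing phi g y l lam' t).
  apply: (sub_has_derivative_on sub).
  exact: (variation_of_constants psi_cont Phi0 hPhi (f_cont lam')).
have xiy t : t0 <= t <= t0 + T -> ((firstv R (m.+1 + r))^T *m xi t) 0 0 = y t.
  by move=> tT; rewrite -st1// /yhat -mulmxDr.
have lamE : lam' = lam.
  apply: identify (observer_state hxi xiy) _ => t tT.
  by rewrite /output -firstv_usubmx xiy.
exists x; split; last by move=> t _.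
by rewrite lamE; split; [exact: x_t0|rewrite -y_output; exact: hxT].
Qed.
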